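(* Let $E$ be an order continuous Banach lattice or a Köthe function space. The following are equivalent: (1) $E$ is upper locally uniformly monotone. (2) The complexification $E^{\mathbb{C}}$ is locally uniformly complex convex. (3) $E^{(p)}$ is midpoint locally uniformly convex for all $1<p<\infty$. (4) $E^{(p)}$ is midpoint locally uniformly convex for some $1<p<\infty$.
   Context: For a Banach lattice $E$ and $1<p<\infty$, the $p$-convexification $E^{(p)}$ is the vector lattice with the same underlying set and order as $E$ but with operations $x\oplus y=(x^{1/p}+y^{1/p})^p$ and $\alpha\odot x=\alpha^p x$ (powers taken as $\mathrm{sign}(t)|t|^s$ via the Krivine functional calculus), normed by $\|x\|_{E^{(p)}}=\|x\|_E^{1/p}$. For $1\le q<\infty$, $x\in S_E$, $\epsilon>0$ let $N_q(\epsilon;x)=\inf\{\|(|x|^q+|y|^q)^{1/q}\|-1:\|y\|\ge\epsilon\}$; $E$ is upper locally uniformly monotone if for some $1\le q<\infty$, $N_q(\epsilon;x)>0$ for all $x\in S_E$ and $\epsilon>0$. The complexification $E^{\mathbb{C}}=\{x+iy:x,y\in E\}$ has norm $\|x+iy\|=\|(|x|^2+|y|^2)^{1/2}\|_E$. In a complex Banach space $X$, a point $x\in S_X$ is a complex strongly extreme point if there is $0<q<\infty$ such that for every $\epsilon>0$, $\inf\{(\frac{1}{2\pi}\int_0^{2\pi}\|x+e^{i\theta}y\|^q\,d\theta)^{1/q}-1:\|y\|\ge\epsilon\}>0$; $X$ is locally uniformly complex convex if every point of $S_X$ is a complex strongly extreme point. A real Banach space $Y$ is midpoint locally uniformly convex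 if every $x\in S_Y$ is a strongly extreme point of $B_Y$, i.e. for every $\epsilon>0$ there is $\delta>0$ with $\inf\{\max\{\|x+y\|,\|x-y\|\}:\|y\|\ge\epsilon\}\ge1+\delta$. *)

(* Defs.v *)
From HB Require Import structures.
From mathcomp Require Import all_boot all_order all_algebra.
From mathcomp Require Import all_classical all_reals all_analysis.
Set Implicit Arguments. Unset Strict Implicit. Unset Printing Implicit Defensive.
Import Order.TTheory GRing.Theory Num.Theory.
Import numFieldNormedType.Exports.
Local Open Scope classical_set_scope.
Local Open Scope ring_scope.

Section BL.
Variables (R : realType) (E : completeNormedModType R) (le : E -> E -> Prop).

Definition is_sup2 (x y z : E) : Prop :=
  le x z /\ le y z /\ forall w, le x w -> le y w -> le z w.

(** lattice join x \/ y (chosen classically; unique when le is a partial order) *)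
Definition ljoin (x y : E) : E := xget 0 [set z | is_sup2 x y z].

Definition lmod (x : E) : E := ljoin x (- x).

Definition banach_lattice : Prop :=
  (forall x, le x x) /\
  (forall x y, le x y -> le y x -> x = y) /\
  (forall x y z, le x y -> le y z -> le x z) /\
  (forall x y z, le x y -> le (x + z) (y + z)) /\
  (forall (a : R) x y, 0 <= a -> le x y -> le (a *: x) (a *: y)) /\
  (forall x y, exists z, is_sup2 x y z) /\
  (forall x y, le (lmod x) (lmod y) -> `|x| <= `|y|).

(** Order continuity: every downward directed set with infimum 0
    (i.e. every net decreasing to 0) has norms going to 0. *)
Definition order_continuous : Prop :=
  forall D : set E, D !=set0 ->
    (forall x, D x -> le 0 x) ->
    (forall a b, D a -> D b -> exists2 c, D c & le c a /\ le c b) ->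
    (forall w, (forall x, D x -> le w x) -> le w 0) ->
    forall eps : R, 0 < eps -> exists2 x, D x & `|x| < eps.

(** Köthe function space: E is lattice isometric (via J, norm transported)
    to an order ideal of L^0 of a complete sigma-finite measure space
    containing the indicators of all sets of finite measure. *)
Definition kothe_function_space : Prop :=
  exists (d : measure_display) (T : measurableType d)
         (mu : {measure set T -> \bar R}) (J : E -> T -> R),
  measure_is_complete mu /\
  sigma_finite setT mu /\
  (forall x, measurable_fun setT (J x)) /\
  (forall x y (a : R), {ae mu, forall t, J (x + a *: y) t = J x t + a * J y t}) /\
  (forall x y, le x y <-> {ae mu, forall t, J x t <= J y t}) /\
  (forall x (g : T -> R), measurable_fun setT g ->
      {ae mu, forall t, `|g t| <= `|J x t|} ->
      exists y, {ae mu, forall t, J y t = g t}) /\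
  (forall A, measurable A -> (mu A < +oo)%E ->
      exists x, {ae mu, forall t, J x t = \1_A t}).

Definition H2 (f : R -> R -> R) : Prop :=
  continuous (fun v : R * R => f v.1 v.2) /\
  forall (a s t : R), 0 <= a -> f (a * s) (a * t) = a * f s t.

Definition lattice_hom2 (Phi : (R -> R -> R) -> E) : Prop :=
  forall f g, H2 f -> H2 g ->
    [/\ Phi (fun s t => f s t + g s t) = Phi f + Phi g,
        (forall a : R, Phi (fun s t => a * f s t) = a *: Phi f) &
        Phi (fun s t => Num.max (f s t) (g s t)) = ljoin (Phi f) (Phi g)].

(** Krivine functional calculus: f(x, y) := Phi f where Phi is the (unique,
    by Krivine's theorem) lattice homomorphism H_2 -> E sending the
    coordinate projections to x and y. *)
Definition krivine2 (f : R -> R -> R) (x y : E) : E :=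
  xget 0 [set z | exists Phi, [/\ lattice_hom2 Phi,
                                 Phi (fun s t => s) = x,
                                 Phi (fun s t => t) = y & Phi f = z]].

Definition spow (t s : R) : R := Num.sg t * powR `|t| s.

Definition qsum (q : R) (s t : R) : R := powR (powR `|s| q + powR `|t| q) q^-1.

Definition ULUM : Prop :=
  exists q : R, 1 <= q /\
    forall x : E, `|x| = 1 -> forall eps : R, 0 < eps ->
      exists2 delta : R, 0 < delta &
        forall y : E, eps <= `|y| -> 1 + delta <= `|krivine2 (qsum q) x y|.

(** complexification E^C = E x E with norm ||(|x|^2+|y|^2)^(1/2)|| *)
Definition cnorm (z : E * E) : R :=
  `|krivine2 (fun s t => Num.sqrt (s ^+ 2 + t ^+ 2)) z.1 z.2|.

(** z + e^{i theta} w in E^C *)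
Definition crot (z w : E * E) (th : R) : E * E :=
  (z.1 + (cos th *: w.1 - sin th *: w.2), z.2 + (sin th *: w.1 + cos th *: w.2)).

Definition complex_strongly_extreme (z : E * E) : Prop :=
  exists q : R, 0 < q /\ forall eps : R, 0 < eps ->
    exists2 delta : R, 0 < delta &
      forall w : E * E, eps <= cnorm w ->
        1 + delta <= powR ((2 * pi)^-1 *
           Rintegral lebesgue_measure `[0, 2 * pi]%classic
             (fun th => powR (cnorm (crot z w th)) q)) q^-1.

Definition LUCC : Prop :=
  forall z : E * E, cnorm z = 1 -> complex_strongly_extreme z.

Definition padd (p : R) (x y : E) : E :=
  krivine2 (fun s t => spow (spow s p^-1 + spow t p^-1) p) x y.
Definition psc (p : R) (a : R) (x : E) : E := spow a p *: x.
Definition pnorm (p : R) (x : E) : R := powR `|x| p^-1.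

Definition midpoint_LUC_conv (p : R) : Prop :=
  forall x : E, pnorm p x = 1 -> forall eps : R, 0 < eps ->
    exists2 delta : R, 0 < delta &
      forall y : E, eps <= pnorm p y ->
        1 + delta <= Num.max (pnorm p (padd p x y))
                             (pnorm p (padd p x (psc p (-1) y))).

End BL.

(* Main.v *)
(* Every inequality below is reduced to one between real numbers. The principal
   ideal generated by u >= 0 in a Banach lattice has enough real-valued lattice
   homomorphisms phi with phi u = 1 to detect its order (they are the minimal
   functionals that are sublinear and preserve suprema), and Krivine's calculus
   satisfies phi (f(x, y)) = f (phi x, phi y). The equivalences then follow from
   homogeneous estimates on R^2 and R^4. If k is continuous, homogeneous,
   nonnegative and k(s, t) > 0 for t <> 0, then |t| <= C k(s, t) + e |s|; so upper
   monotonicity at x forces ||h(x, y)|| away from 1 for every h(s, t) > |s|.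
   (1) -> (3) uses h = (|s (+) t| + |s (-) t|) / 2; (1) -> (2) averages the four
   rotations z + i^k w; (2) -> (1) uses |x + e^{i theta} y| <= |x| + |y|; and
   (4) -> (1) writes |x| + |y| = |x| (+) v, with v bounded below in terms of y. *)

Require Import Defs.
From HB Require Import structures.
From mathcomp Require Import all_boot all_order all_algebra.
From mathcomp Require Import all_classical all_reals all_analysis.
From mathcomp Require Import ring lra.
Set Implicit Arguments. Unset Strict Implicit. Unset Printing Implicit Defensive.
Import Order.TTheory GRing.Theory Num.Theory.
Import numFieldNormedType.Exports.
Local Open Scope classical_set_scope.
Local Open Scope ring_scope.

(** * Real lattice homomorphisms on principal ideals *)

(** Since [krivine2] is defined by choice among homomorphisms, nothing can be computed with it
    before one is shown to exist, and two uses of it need not choose the same one. Existence comes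
    from compactness and completeness on the ideal of |x| + |y|. Every choice gives the same values,
    because composing it with a character leaves a real homomorphism on the homogeneous functions,
    which must be evaluation at a point. Characters stand for the points of a representing compact
    space that is never built: restricting a functional to the face where x is maximal lowers it
    strictly unless it is already odd at x, so minimal functionals are linear. The exponent q of
    upper monotonicity disappears through (|s|^q + k^q)^(1/q) <= |s| + k with k = h - |s|:
    monotonicity is applied to k(x, y) in place of y. The bound of |t| by k keeps the norm of k(x,
    y) away from 0, the term e |x| being absorbed because x has norm 1. *)

Lemma maxrN (R : realDomainType) (s : R) : Num.max s (- s) = `|s|.
Proof.
by rewrite maxEle; case: ifPn; rewrite -?ltNge => ?;
  [rewrite ler0_norm|rewrite gtr0_norm]; lra.
Qed.

Section BanachLattice.
Variables (R : realType) (E : completeNormedModType R) (le : E -> E -> Prop).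
Hypothesis lattE : banach_lattice le.
Implicit Types (x y z u v w : E) (a b c : R).

Local Notation "x <=E y" := (le x y) (at level 70, y at next level).
Local Notation "x \/E y" := (ljoin le x y) (at level 50, left associativity).

Lemma ble_refl x : x <=E x.
Proof. by case: lattE => + _; exact. Qed.
Hint Resolve ble_refl : core.

Lemma ble_anti x y : x <=E y -> y <=E x -> x = y.
Proof. by case: lattE => _ [+ _]; exact. Qed.

Lemma ble_trans y x z : x <=E y -> y <=E z -> x <=E z.
Proof. by case: lattE => _ [_ [+ _]]; exact. Qed.

Lemma ble_add2r z x y : x <=E y -> x + z <=E y + z.
Proof. by case: lattE => _ [_ [_ [+ _]]]; exact. Qed.

Lemma bleZ a x y : 0 <= a -> x <=E y -> a *: x <=E a *: y.
Proof. by case: lattE => _ [_ [_ [_ [+ _]]]]; exact. Qed.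

Lemma ljoin_sup x y : is_sup2 le x y (x \/E y).
Proof.
case: lattE => _ [_ [_ [_ [_ [+ _]]]]] => /(_ x y) h.
exact: (@xgetPex _ 0 [set z | is_sup2 le x y z] h).
Qed.

Lemma ble_norm x y : lmod le x <=E lmod le y -> `|x| <= `|y|.
Proof. by case: lattE => _ [_ [_ [_ [_ [_ +]]]]]; exact. Qed.

Lemma ble_joinl x y : x <=E x \/E y. Proof. by case: (ljoin_sup x y). Qed.

Lemma ble_joinr x y : y <=E x \/E y. Proof. by case: (ljoin_sup x y) => ? []. Qed.

Lemma ljoin_ble x y z : x <=E z -> y <=E z -> x \/E y <=E z.
Proof. by case: (ljoin_sup x y) => ? [_ +]; exact. Qed.

Lemma ljoinE x y z : is_sup2 le x y z -> x \/E y = z.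
Proof.
move=> [xz [yz zmin]]; apply: ble_anti; first exact: ljoin_ble.
by apply: zmin; [exact: ble_joinl|exact: ble_joinr].
Qed.

Lemma ljoin_r x y : x <=E y -> x \/E y = y.
Proof. by move=> xy; apply: ljoinE; split=> //; split. Qed.

Lemma bleD x y z w : x <=E y -> z <=E w -> x + z <=E y + w.
Proof.
move=> xy zw; apply: (@ble_trans (y + z)); first exact: ble_add2r.
by rewrite ![y + _]addrC; exact: ble_add2r.
Qed.

Lemma subr_bge0 x y : 0 <=E y - x <-> x <=E y.
Proof.
split=> [/(ble_add2r x)|/(ble_add2r (- x))]; first by rewrite add0r subrK.
by rewrite subrr.
Qed.

Lemma ble_subr0 x y : x - y <=E 0 <-> x <=E y.
Proof.
split=> [/(ble_add2r y)|/(ble_add2r (- y))]; first by rewrite add0r subrK.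
by rewrite subrr.
Qed.

Lemma bleN2 x y : x <=E y -> - y <=E - x.
Proof. by move=> /subr_bge0 xy; apply/subr_bge0; rewrite opprK addrC. Qed.

Lemma bleZl a b x : 0 <=E x -> a <= b -> a *: x <=E b *: x.
Proof.
move=> x0 ab; apply/subr_bge0; rewrite -scalerBl -(scaler0 _ (b - a)).
by apply: bleZ => //; rewrite subr_ge0.
Qed.

Section Ideal.
Variable u : E.
Hypothesis u0 : 0 <=E u.

Definition pideal x := exists a, x <=E a *: u /\ - x <=E a *: u.

Lemma pideal_pos x : pideal x -> exists2 a, 0 < a & x <=E a *: u /\ - x <=E a *: u.
Proof.
move=> [a [xa Nxa]]; exists (`|a| + 1); first by rewrite ltr_wpDl.
have aa : a *: u <=E (`|a| + 1) *: u.
  by apply: bleZl => //; rewrite (le_trans (ler_norm _))// lerDl.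
by split; exact: ble_trans aa.
Qed.

Lemma pidealN x : pideal x -> pideal (- x).
Proof. by move=> [a [? ?]]; exists a; rewrite opprK. Qed.

Lemma pidealD x y : pideal x -> pideal y -> pideal (x + y).
Proof.
move=> [a [xa Nxa]] [b [yb Nyb]]; exists (a + b); rewrite scalerDl opprD.
by split; exact: bleD.
Qed.

Lemma pidealZ a x : pideal x -> pideal (a *: x).
Proof.
move=> /pideal_pos[b b0 [xb Nxb]]; exists (`|a| * b).
wlog a0 : a x xb Nxb / 0 <= a => [h|].
  have [a0|a0] := leP 0 a; first exact: h.
  have := h (- a) (- x) Nxb; rewrite opprK normrN => /(_ xb).
  rewrite oppr_ge0 => /(_ (ltW a0)).
  by rewrite scalerN scaleNr opprK.
rewrite ger0_norm// -scalerN -scalerA.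
by split; exact: bleZ.
Qed.

Lemma pidealJ x y : pideal x -> pideal y -> pideal (x \/E y).
Proof.
move=> /pideal_pos[a a0 [xa Nxa]] /pideal_pos[b b0 [yb Nyb]].
exists (a + b); split.
  apply: ljoin_ble.
    by apply: (ble_trans xa); apply: bleZl => //; rewrite lerDl ltW.
  by apply: (ble_trans yb); apply: bleZl => //; rewrite lerDr ltW.
apply: (@ble_trans (a *: u)); last by apply: bleZl => //; rewrite lerDl ltW.
by apply: ble_trans Nxa; apply: bleN2; exact: ble_joinl.
Qed.

Lemma pidealu : pideal u.
Proof.
exists 1; rewrite scale1r; split => //.
by apply: (@ble_trans 0) => //; rewrite -oppr0; exact: bleN2.
Qed.

Lemma pideal0 : pideal 0.
Proof. by rewrite -(scale0r u); apply: pidealZ; exact: pidealu. Qed.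

Lemma pidealB x y : pideal x -> pideal y -> pideal (x - y).
Proof. by move=> ? ?; apply: pidealD => //; exact: pidealN. Qed.

Lemma pideal_lmod x : pideal x -> pideal (lmod le x).
Proof. by move=> ?; apply: pidealJ => //; exact: pidealN. Qed.

(** [phi] is a total function on [E] but is constrained only on the ideal of [u]. The condition
    [phi u = 1] makes [u] play the role of the constant function 1. *)
Definition lattice_char (phi : E -> R) := [/\
  forall x y, pideal x -> pideal y -> phi (x + y) = phi x + phi y,
  forall a x, pideal x -> phi (a *: x) = a * phi x,
  forall x y, pideal x -> pideal y -> phi (x \/E y) = Num.max (phi x) (phi y) &
  phi u = 1].

(* On C(K) these are the functionals f |-> max_A f, A a nonempty closed subset
   of K; the minimal ones are the point evaluations. *)
Definition sup_functional (M : E -> R) := [/\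
  forall x y, pideal x -> pideal y -> x <=E y -> M x <= M y,
  forall x y, pideal x -> pideal y -> M (x + y) <= M x + M y,
  forall a x, 0 < a -> pideal x -> M (a *: x) <= a * M x,
  forall x y, pideal x -> pideal y -> M (x \/E y) <= Num.max (M x) (M y) &
  M u <= 1 /\ M (- u) <= -1].

(** * Sublinear functionals that respect maxima, and their minimal elements *)

Section SupFunctional.
Variable M : E -> R.
Hypothesis supM : sup_functional M.

Let monoM x y : pideal x -> pideal y -> x <=E y -> M x <= M y.
Proof. by case: supM => + _ _ _ _; exact. Qed.
Let subM x y : pideal x -> pideal y -> M (x + y) <= M x + M y.
Proof. by case: supM => _ + _ _ _; exact. Qed.
Let homM a x : 0 < a -> pideal x -> M (a *: x) <= a * M x.
Proof. by case: supM => _ _ + _ _; exact. Qed.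

(** Scaling 0 by 2 gives [0 <= M 0], scaling it by 1/2 gives [M 0 <= 0]. *)
Lemma sup_functional0 : M 0 = 0.
Proof.
apply/eqP; rewrite eq_le.
have := @homM 2^-1 0 _ pideal0; have := @homM 2 0 _ pideal0.
rewrite !scaler0 => /(_ ltac:(lra)) ? /(_ ltac:(lra)) ?.
by apply/andP; split; lra.
Qed.

(** Only one inequality is part of [sup_functional]; using it for both [a] and [a^-1] gives
    equality. *)
Lemma sup_functionalZ a x : 0 <= a -> pideal x -> M (a *: x) = a * M x.
Proof.
rewrite le_eqVlt => /predU1P[<-|a0] Ix.
  by rewrite scale0r mul0r sup_functional0.
apply/eqP; rewrite eq_le homM//= -ler_pdivlMl//.
have := @homM a^-1 (a *: x); rewrite scalerA mulVf ?gt_eqF// scale1r.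
by apply; rewrite ?invr_gt0//; exact: pidealZ.
Qed.

Lemma sup_functional_scale_unit c : M (c *: u) <= c.
Proof.
case: supM => _ _ _ _ [Mu MNu].
have [c0|c0] := leP 0 c.
  by rewrite sup_functionalZ//; [rewrite ler_piMr|exact: pidealu].
rewrite -[c]opprK scaleNr -scalerN sup_functionalZ; last first.
- exact/pidealN/pidealu.
- by rewrite oppr_ge0 ltW.
by nra.
Qed.

(** The bound is the same for all [M], so infima over chains of such functionals stay finite. It
    follows from 0 = M 0 <= M x + M (- x) and M (- x) <= a. *)
Lemma sup_functional_lower a x : 0 < a -> pideal x -> - x <=E a *: u -> - a <= M x.
Proof.
move=> a0 Ix xa; have INx := pidealN Ix.
have := monoM INx (pidealZ a pidealu) xa.
have := sup_functional_scale_unit a.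
by have := subM Ix INx; rewrite subrr sup_functional0; lra.
Qed.

End SupFunctional.

(* The infimum of a suitably directed family of functionals; this covers both
   chains (M3 the smaller of M1 and M2) and the one-parameter family of
   [sup_functional_restrict]. *)
Lemma sup_functional_inf (D : set (E -> R)) : D !=set0 ->
  (forall x, pideal x -> has_lbound [set M x | M in D]) ->
  (forall M, D M -> forall x y, pideal x -> pideal y -> x <=E y -> M x <= M y) ->
  (forall M1 M2, D M1 -> D M2 -> exists2 M3, D M3 & forall x y,
     pideal x -> pideal y -> M3 (x + y) <= M1 x + M2 y) ->
  (forall M a, D M -> 0 < a -> exists2 M', D M' & forall x,
     pideal x -> M' (a *: x) <= a * M x) ->
  (forall M1 M2, D M1 -> D M2 -> exists2 M3, D M3 & forall x y,
     pideal x -> pideal y -> M3 (x \/E y) <= Num.max (M1 x) (M2 y)) ->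
  (exists2 M, D M & M u <= 1) -> (exists2 M, D M & M (- u) <= -1) ->
  sup_functional (fun x => inf [set M x | M in D]).
Proof.
move=> [M0 DM0] lbD monoD subD homD supD Du DNu.
have infle M x : D M -> pideal x -> inf [set M x | M in D] <= M x.
  by move=> DM Ix; apply: ge_inf; [exact: lbD|exists M].
have adh x e : pideal x -> 0 < e ->
    exists2 M, D M & M x < inf [set M x | M in D] + e.
  move=> Ix e0.
  have [|_ [M DM <-] Mlt] := @inf_adherent _ [set M x | M in D] e e0.
    by split; [exists (M0 x); exists M0|exact: lbD].
  by exists M.
have inf_ge x b : (forall M, D M -> b <= M x) -> b <= inf [set M x | M in D].
  by move=> h; apply: lb_le_inf; [exists (M0 x), M0|move=> _ [M DM <-]; exact: h].
split.
- move=> x y Ix Iy xy; apply: inf_ge => M DM.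
  by apply: le_trans (monoD _ DM _ _ Ix Iy xy); exact: infle.
- move=> x y Ix Iy; apply/ler_addgt0Pr => e e0.
  have e20 : 0 < e / 2 by rewrite divr_gt0.
  have [M1 DM1 h1] := adh x _ Ix e20; have [M2 DM2 h2] := adh y _ Iy e20.
  have [M3 DM3 h3] := subD _ _ DM1 DM2.
  by have := h3 _ _ Ix Iy; have := infle _ _ DM3 (pidealD Ix Iy); lra.
- move=> a x a0 Ix; rewrite -ler_pdivrMl//; apply: inf_ge => M DM.
  have [M' DM' h'] := homD _ _ DM a0; rewrite ler_pdivrMl//.
  by apply: le_trans (h' _ Ix); apply: infle => //; exact: pidealZ.
- move=> x y Ix Iy; apply/ler_addgt0Pr => e e0.
  have [M1 DM1 h1] := adh x _ Ix e0; have [M2 DM2 h2] := adh y _ Iy e0.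
  have [M3 DM3 h3] := supD _ _ DM1 DM2.
  have := h3 _ _ Ix Iy; have := infle _ _ DM3 (pidealJ Ix Iy).
  by rewrite !maxEle; do 2 case: ifPn; rewrite -?ltNge; lra.
- case: Du => M DM Mu; case: DNu => M' DM' M'u; split.
    by apply: le_trans Mu; apply: infle => //; exact: pidealu.
  by apply: le_trans M'u; apply: infle => //; exact/pidealN/pidealu.
Qed.

(* Restricts the functional to the set where [x] attains its maximum. *)
Lemma sup_functional_restrict M x : sup_functional M -> pideal x ->
  exists M', [/\ sup_functional M', forall y, pideal y -> M' y <= M y &
    M' (- x) <= - M x].
Proof.
move=> supM Ix; have [monoM subM homM joinM [Mu MNu]] := supM.
(* In the model where [M] is the maximum over A, [d] is nonpositive on A and vanishes where [x] is
   maximal. Adding [t *: d] with t large penalises the rest of A, so the infimum over t is the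
   maximum over that face. *)
pose d := x - M x *: u.
have Iu := pidealu.
have Id : pideal d by apply: pidealB => //; exact: pidealZ.
have Itd t : pideal (t *: d) by exact: pidealZ.
have Md : M d = 0.
  apply/eqP; rewrite eq_le; apply/andP; split.
    have := subM _ _ Ix (pidealN (pidealZ (M x) Iu)).
    by have := sup_functional_scale_unit supM (- M x); rewrite scaleNr -/d; lra.
  have := subM _ _ Id (pidealZ (M x) Iu).
  by have := sup_functional_scale_unit supM (M x); rewrite subrK; lra.
have Mtd t : 0 <= t -> M (t *: d) = 0.
  by move=> t0; rewrite sup_functionalZ// Md mulr0.
(* As [M] vanishes on the nonnegative multiples of [d], subadditivity makes the family decrease in
   t; different parameters can then be raised to a common one. *)
have decr y s t : pideal y -> 0 <= s -> s <= t -> M (y + t *: d) <= M (y + s *: d).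
  move=> Iy s0 st; have := subM _ _ (pidealD Iy (Itd s)) (Itd (t - s)).
  by rewrite -addrA -scalerDl addrCA subrr addr0 Mtd ?subr_ge0//; lra.
pose D := [set N | exists2 t, 0 <= t & N = fun y => M (y + t *: d)].
have DM t : 0 <= t -> D (fun y => M (y + t *: d)) by exists t.
exists (fun y => inf [set N y | N in D]).
have lbD y : pideal y -> has_lbound [set N y | N in D].
  move=> Iy; exists (- M (- y)) => _ [_ [t t0 ->] <-].
  have := subM _ _ (pidealD Iy (Itd t)) (pidealN Iy).
  by rewrite addrAC subrr add0r Mtd//; lra.
have infle t y : 0 <= t -> pideal y -> inf [set N y | N in D] <= M (y + t *: d).
  move=> t0 Iy; apply: ge_inf; first exact: lbD.
  by exists (fun y => M (y + t *: d)) => //; exact: DM.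
split.
- apply: sup_functional_inf => //.
  + by exists (fun y => M (y + 0 *: d)); exact: DM.
  + move=> _ [t t0 ->] y z Iy Iz yz.
    by apply: monoM; [exact: pidealD|exact: pidealD|exact: ble_add2r].
  + move=> _ _ [s s0 ->] [t t0 ->]; exists (fun y => M (y + (s + t) *: d)).
      by apply: DM; rewrite addr_ge0.
    move=> y z Iy Iz; rewrite scalerDl addrACA.
    by apply: subM; exact: pidealD.
  + move=> _ a [t t0 ->] a0; exists (fun y => M (y + (a * t) *: d)).
      by apply: DM; rewrite mulr_ge0// ltW.
    by move=> y Iy; rewrite -scalerA -scalerDr; apply: homM => //; exact: pidealD.
  + move=> _ _ [s s0 ->] [t t0 ->].
    (* Translation commutes with the join only when both arguments move by the same vector, hence
       the common parameter. *)
    exists (fun y => M (y + Num.max s t *: d)).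
      by apply: DM; rewrite le_max s0.
    move=> y z Iy Iz; set m := Num.max s t.
    have -> : (y \/E z) + m *: d = (y + m *: d) \/E (z + m *: d).
      apply/esym/ljoinE; split; first exact/ble_add2r/ble_joinl.
      split; first exact/ble_add2r/ble_joinr.
      move=> w yw zw; rewrite -[w](subrK (m *: d)); apply: ble_add2r.
      by apply: ljoin_ble; rewrite -[X in le X _](addrK (m *: d)); exact: ble_add2r.
    apply: (le_trans (joinM _ _ (pidealD Iy (Itd m)) (pidealD Iz (Itd m)))).
    by rewrite ge_max !le_max !decr// ?orbT// /m le_max lexx ?orbT.
  + by exists (fun y => M (y + 0 *: d)); [exact: DM|rewrite scale0r addr0].
  + by exists (fun y => M (y + 0 *: d)); [exact: DM|rewrite scale0r addr0].
- by move=> y Iy; have := @infle 0 y (lexx _) Iy; rewrite scale0r addr0.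
(* The parameter t = 1 is enough, because - x + d = - M x *: u. *)
- have := @infle 1 (- x) ler01 (pidealN Ix).
  rewrite scale1r /d addKr.
  by have := sup_functional_scale_unit supM (- M x); rewrite scaleNr; lra.
Qed.

(** Zorn's lemma gives a minimal [M]. Its restriction at x lies below [M], hence agrees with it on
    the ideal, so M (- x) <= - M x; the opposite inequality is subadditivity. *)
Lemma minimal_sup_functional M0 : sup_functional M0 -> exists M,
  [/\ sup_functional M, forall y, pideal y -> M y <= M0 y &
   forall x, pideal x -> M (- x) = - M x].
Proof.
move=> supM0.
pose T := {M | sup_functional M /\ forall y, pideal y -> M y <= M0 y}.
(* [S M N] puts N below M, so a maximal element for [S] is a minimal functional. Functionals that
   differ only off the ideal are equivalent, hence a preorder. *)
pose S (M N : T) := `[< forall y, pideal y -> sval N y <= sval M y >].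
have t0 : T by exists M0; split.
have [||A Atot|[M [supM MM0]] Mmin] := @ZL_preorder T t0 S.
- by move=> [M ?]; apply/asboolP.
- move=> s r t /asboolP rs /asboolP st; apply/asboolP => y Iy.
  by apply: le_trans (rs y Iy); exact: st.
- have [[a Aa]|A0] := pselect (A !=set0); last first.
    by exists t0 => s As; exfalso; apply: A0; exists s.
  pose D := [set sval M | M in A].
  have DA M : A M -> D (sval M) by exists M.
  have supD M : D M -> sup_functional M by move=> [[M' []] ? ? _ <-].
  have lbD y : pideal y -> has_lbound [set N y | N in D].
    move=> Iy; have [c c0 [yc Nyc]] := pideal_pos Iy.
    exists (- c) => _ [N DN <-].
    exact: (sup_functional_lower (supD _ DN)).
  have dirD N1 N2 : D N1 -> D N2 -> exists2 N, D N & forall y, pideal y ->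
      N y <= N1 y /\ N y <= N2 y.
    move=> [M1 AM1 <-] [M2 AM2 <-].
    have [/asboolP h|/asboolP h] := Atot _ _ AM1 AM2.
      by exists (sval M2) => [|y Iy]; [exact: DA|split => //; exact: h].
    by exists (sval M1) => [|y Iy]; [exact: DA|split => //; exact: h].
  have supI : sup_functional (fun x => inf [set M x | M in D]).
    apply: sup_functional_inf => //.
    + by exists (sval a); exact: DA.
    + by move=> N /supD[].
    + move=> N1 N2 D1 D2; have [N DN h] := dirD _ _ D1 D2.
      exists N => // y z Iy Iz; have [_ sN _ _ _] := supD _ DN.
      by apply: (le_trans (sN _ _ Iy Iz)); apply: lerD; apply h.
    + by move=> N c DN c0; exists N => // y Iy; have [_ _ hN _ _] := supD _ DN; exact: hN.
    + move=> N1 N2 D1 D2; have [N DN h] := dirD _ _ D1 D2.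
      exists N => // y z Iy Iz; have [_ _ _ jN _] := supD _ DN.
      apply: (le_trans (jN _ _ Iy Iz)).
      have [h1 _] := h _ Iy; have [_ h2] := h _ Iz.
      by rewrite ge_max !le_max h1 h2 orbT.
    + by exists (sval a); [exact: DA|have [_ _ _ _ []] := supD _ (DA _ Aa)].
    + by exists (sval a); [exact: DA|have [_ _ _ _ []] := supD _ (DA _ Aa)].
  have infle (N : T) y : A N -> pideal y -> inf [set M y | M in D] <= sval N y.
    move=> AN Iy; apply: ge_inf; first exact: lbD.
    by exists (sval N) => //; exact: DA.
  have h : sup_functional (fun x => inf [set M x | M in D]) /\
      forall y, pideal y -> inf [set M y | M in D] <= M0 y.
    split=> // y Iy; apply: (le_trans (infle _ _ Aa Iy)).
    by case: (a) => N [] /= _; exact.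
  by exists (exist _ (fun x => inf [set M x | M in D]) h : T) => N AN; apply/asboolP => y Iy /=; exact: infle.
- exists M; split=> // x Ix.
  have [M' [supM' M'M M'x]] := sup_functional_restrict supM Ix.
  have hM' : sup_functional M' /\ forall y, pideal y -> M' y <= M0 y.
    by split=> // y Iy; apply: le_trans (MM0 y Iy); exact: M'M.
  have /asboolP MM' := Mmin (exist _ M' hM') ltac:(apply/asboolP; exact: M'M).
  have /= := MM' _ (pidealN Ix); have [_ subM _ _ _] := supM.
  have := subM _ _ Ix (pidealN Ix); rewrite subrr sup_functional0// => h1 h2.
  by apply/eqP; rewrite eq_le; apply/andP; split; lra.
Qed.

(** * Order and norm are detected by characters *)

Lemma ble_norm_pos x y : 0 <=E x -> x <=E y -> `|x| <= `|y|.
Proof.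
have lmodE z : 0 <=E z -> lmod le z = z.
  move=> z0; apply: ljoinE; split=> //; split=> //.
  by apply: (ble_trans _ z0); rewrite -oppr0; exact: bleN2.
move=> x0 xy; apply: ble_norm; rewrite !lmodE//; exact: (ble_trans x0 xy).
Qed.

(** The Archimedean property comes from the norm: the positive part of v lies below every e u, so
    its norm is 0. *)
Lemma ble_archimedean v : (forall e, 0 < e -> v <=E e *: u) -> v <=E 0.
Proof.
move=> h; have vj := ble_joinl v 0; have j0 := ble_joinr v 0.
suff -> : 0 = v \/E 0 by [].
apply/esym/normr0_eq0/eqP; rewrite eq_le normr_ge0 andbT.
apply/ler_addgt0Pr => e e0; rewrite add0r.
have u1 : 0 < `|u| + 1 by rewrite ltr_wpDl.
have h1 : v \/E 0 <=E (e / (`|u| + 1)) *: u.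
  apply: ljoin_ble; first by apply: h; rewrite divr_gt0.
  by rewrite -(scaler0 _ (e / (`|u| + 1))); apply: bleZ => //; rewrite divr_ge0// ltW.
apply: (le_trans (ble_norm_pos j0 h1)).
rewrite normrZ gtr0_norm ?divr_gt0// mulrAC ler_pdivrMr// ler_pM2l//.
by rewrite lerDl.
Qed.

(** On C(K) with u = 1 this is the maximum over all of K, the largest of the [sup_functional]s. *)
Definition gauge v := inf [set a | v <=E a *: u].

(** From v <= a u and - v <= b u one gets 0 <= (a + b) u, which with a + b < 0 would force u <=
    0. *)
Lemma gauge_lbound v : ~ u <=E 0 -> pideal v -> has_lbound [set a | v <=E a *: u].
Proof.
move=> un0 [b [_ Nvb]]; exists (- b) => a /= va.
rewrite -subr_ge0 opprK leNgt; apply/negP => ab0; apply: un0.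
have := bleD va Nvb; rewrite subrr -scalerDl => h.
have : 0 <= - (a + b)^-1 by rewrite oppr_ge0 invr_le0 ltW.
move=> /bleZ/(_ h); rewrite scaler0 scalerA mulNr mulVf ?lt_eqF//.
by rewrite scaleN1r => /bleN2; rewrite opprK oppr0.
Qed.

Lemma gauge_lt v a : pideal v -> gauge v < a -> v <=E a *: u.
Proof.
move=> [b [vb _]] /inf_lt[|c /= vc ca]; first by exists b.
by apply: (ble_trans vc); apply: bleZl => //; exact: ltW.
Qed.

Lemma gauge_sup_functional : ~ u <=E 0 -> sup_functional gauge.
Proof.
move=> un0.
have gle x a : pideal x -> x <=E a *: u -> gauge x <= a.
  by move=> Ix xa; apply: ge_inf => //; exact: gauge_lbound.
have gD x y : pideal x -> pideal y -> gauge (x + y) <= gauge x + gauge y.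
  move=> Ix Iy; apply/ler_addgt0Pr => e e0.
  have -> : gauge x + gauge y + e = (gauge x + e / 2) + (gauge y + e / 2) by lra.
  apply: gle; [exact: pidealD|rewrite scalerDl].
  by apply: bleD; apply: gauge_lt => //; lra.
split=> //.
- move=> x y Ix Iy xy; apply/ler_addgt0Pr => e e0; apply: gle => //.
  by apply: (ble_trans xy); apply: gauge_lt => //; lra.
- move=> a x a0 Ix; rewrite -ler_pdivrMl//; apply/ler_addgt0Pr => e e0.
  rewrite ler_pdivrMl//; apply: gle; first exact: pidealZ.
  by rewrite -scalerA; apply: bleZ; [exact: ltW|apply: gauge_lt => //; lra].
- move=> x y Ix Iy; apply/ler_addgt0Pr => e e0; apply: gle; first exact: pidealJ.
  by apply: ljoin_ble; apply: gauge_lt => //; rewrite maxEle; case: ifPn;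
    rewrite -?ltNge; lra.
split; apply: gle => //; first exact: pidealu.
- by rewrite scale1r; exact: ble_refl.
- exact/pidealN/pidealu.
- by rewrite scaleN1r; exact: ble_refl.
Qed.

(** Oddness reverses subadditivity by applying it to - x and - y; for joins the reverse inequality
    is monotonicity. *)
Lemma sup_functional_char M : sup_functional M ->
  (forall x, pideal x -> M (- x) = - M x) -> lattice_char M.
Proof.
move=> supM MN; have [monoM subM _ joinM [Mu MNu]] := supM.
split.
- move=> x y Ix Iy; apply/eqP; rewrite eq_le subM//=.
  have := subM _ _ (pidealN Ix) (pidealN Iy).
  by rewrite -opprD !MN//; [lra|exact: pidealD].
- move=> a x Ix; have [a0|a0] := leP 0 a; first exact: sup_functionalZ.
  rewrite -[a]opprK scaleNr MN; last exact: pidealZ.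
  by rewrite sup_functionalZ// ?oppr_ge0 ?ltW//; lra.
- move=> x y Ix Iy; apply/eqP; rewrite eq_le joinM//= ge_max.
  have Ixy := pidealJ Ix Iy.
  by rewrite !monoM//; first [exact: ble_joinl|exact: ble_joinr].
- by apply/eqP; rewrite eq_le Mu/=; have := MN _ pidealu; lra.
Qed.

(** If v is not below 0, its gauge is positive. Restricting the gauge to the face where v is maximal
    and then minimising gives an odd functional N with N (- v) <= - gauge v, that is, a character
    with N v > 0. *)
Lemma lattice_char_sep v : pideal v ->
  (forall phi, lattice_char phi -> phi v <= 0) -> v <=E 0.
Proof.
move=> Iv vle0; apply: contrapT => vn0.
have un0 : ~ u <=E 0.
  move=> ule0; apply: vn0; case: (pideal_pos Iv) => a a0 [va _].
  by apply: (ble_trans va); rewrite -(scaler0 _ a); exact/bleZ/ule0/ltW.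
have gv0 : 0 < gauge v.
  rewrite ltNge; apply/negP => gv0; apply: vn0; apply: ble_archimedean => e e0.
  by apply: gauge_lt => //; exact: le_lt_trans e0.
have [M [supM Mg MNv]] := sup_functional_restrict (gauge_sup_functional un0) Iv.
have [N [supN NM NN]] := minimal_sup_functional supM.
have := vle0 _ (sup_functional_char supN NN).
by have := NM _ (pidealN Iv); rewrite NN//; lra.
Qed.

Section Char.
Variable phi : E -> R.
Hypothesis chphi : lattice_char phi.

Lemma lcharD x y : pideal x -> pideal y -> phi (x + y) = phi x + phi y.
Proof. by case: chphi => + _ _ _; exact. Qed.

Lemma lcharZ a x : pideal x -> phi (a *: x) = a * phi x.
Proof. by case: chphi => _ + _ _; exact. Qed.

Lemma lcharN x : pideal x -> phi (- x) = - phi x.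
Proof. by move=> Ix; rewrite -scaleN1r lcharZ// mulN1r. Qed.

Lemma lcharB x y : pideal x -> pideal y -> phi (x - y) = phi x - phi y.
Proof. by move=> Ix Iy; rewrite lcharD ?lcharN//; exact: pidealN. Qed.

Lemma lcharJ x y : pideal x -> pideal y -> phi (x \/E y) = Num.max (phi x) (phi y).
Proof. by case: chphi => _ _ + _; exact. Qed.

Lemma lchar_lmod x : pideal x -> phi (lmod le x) = `|phi x|.
Proof.
move=> Ix; rewrite lcharJ ?lcharN//; last exact: pidealN.
exact: maxrN.
Qed.

Lemma lcharu : phi u = 1. Proof. by case: chphi. Qed.

Lemma lchar_le x y : pideal x -> pideal y -> x <=E y -> phi x <= phi y.
Proof.
move=> Ix Iy xy; have := lcharJ Ix Iy.
by rewrite ljoin_r// => ->; rewrite le_max lexx.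
Qed.

End Char.

Lemma ble_char x y : pideal x -> pideal y ->
  (forall phi, lattice_char phi -> phi x <= phi y) -> x <=E y.
Proof.
move=> Ix Iy h; apply/ble_subr0/lattice_char_sep; first exact: pidealB.
by move=> phi chphi; rewrite lcharB// subr_le0 h.
Qed.

Lemma beq_char x y : pideal x -> pideal y ->
  (forall phi, lattice_char phi -> phi x = phi y) -> x = y.
Proof. by move=> Ix Iy h; apply: ble_anti; apply: ble_char => // phi /h ->. Qed.

(** This is the transfer principle behind all later norm estimates: characters send |x| to the
    scalar absolute value, and the lattice norm is monotone in the modulus. *)
Lemma norm_le_char x y : pideal x -> pideal y ->
  (forall phi, lattice_char phi -> `|phi x| <= `|phi y|) -> `|x| <= `|y|.
Proof.
move=> Ix Iy h; apply/ble_norm/ble_char; try exact: pideal_lmod.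
by move=> phi chphi; rewrite !lchar_lmod// h.
Qed.

Lemma norm_eq_char x y : pideal x -> pideal y ->
  (forall phi, lattice_char phi -> `|phi x| = `|phi y|) -> `|x| = `|y|.
Proof.
by move=> Ix Iy h; apply/eqP; rewrite eq_le !norm_le_char// => phi /h ->.
Qed.

End Ideal.

Lemma lmod_ge0 x : 0 <=E lmod le x.
Proof.
have : 0 <=E lmod le x + lmod le x.
  by rewrite -(subrr x); apply: bleD; [exact: ble_joinl|exact: ble_joinr].
have h : (0 : R) <= 2^-1 by lra.
move=> /(bleZ h); rewrite scaler0 scalerDr -scalerDl.
by have -> : 2^-1 + 2^-1 = 1 :> R by [lra]; rewrite scale1r.
Qed.

Lemma lmodD_ge0 x y : 0 <=E lmod le x + lmod le y.
Proof. by rewrite -(addr0 0); apply: bleD; exact: lmod_ge0. Qed.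

Lemma pideal_ble u x : lmod le x <=E u -> pideal u x.
Proof.
move=> h; exists 1; rewrite scale1r.
by split; apply: ble_trans h; [exact: ble_joinl|exact: ble_joinr].
Qed.

Lemma norm_lmod x : `|lmod le x| = `|x|.
Proof.
have Ix : pideal (lmod le x) x by exact: pideal_ble.
apply: (norm_eq_char (lmod_ge0 x)) => //; first exact/pideal_lmod/Ix/lmod_ge0.
by move=> phi chphi; rewrite (lchar_lmod chphi Ix) normr_id.
Qed.

End BanachLattice.

(** * Continuous functions of two elements *)

Section Calculus.
Variables (R : realType) (E : completeNormedModType R) (le : E -> E -> Prop).
Hypothesis lattE : banach_lattice le.
Implicit Types (x y z w : E) (a b c e : R) (f g : R -> R -> R).

Local Notation "x <=E y" := (le x y) (at level 70, y at next level).
Local Notation "x \/E y" := (ljoin le x y) (at level 50, left associativity).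

(** For x <= w the positive part of z - w lies below |z - x|, so its norm is arbitrarily small. *)
Lemma ble_closed w z :
  (forall e, 0 < e -> exists2 x, x <=E w & `|z - x| < e) -> z <=E w.
Proof.
move=> h; pose v := (z - w) \/E 0.
suff v0 : v = 0 by apply/(ble_subr0 lattE); rewrite -v0; exact: ble_joinl.
apply/normr0_eq0/eqP; rewrite eq_le normr_ge0 andbT.
apply/ler_addgt0Pr => e /h[x xw zx]; rewrite add0r.
apply: le_trans (ltW zx); rewrite -(norm_lmod lattE (z - x)).
apply: (ble_norm_pos lattE); first exact: ble_joinr.
apply: ljoin_ble => //; last exact: lmod_ge0.
apply: ble_trans (ble_joinl lattE _ _) => //.
by apply: bleD => //; [exact: ble_refl|exact: bleN2].
Qed.

Variable u : E.
Hypothesis u0 : 0 <=E u.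
Local Notation ideal := (pideal le u).
Local Notation char := (lattice_char le u).

(** Approximations that are uniform over characters are order bounded differences of each other by
    small multiples of [u], hence norm Cauchy. The order bounds survive in the limit by
    [ble_closed], which keeps the limit in the ideal and close to the approximations on every
    character. *)
Lemma char_closed (F : (E -> R) -> R) :
  (forall e, 0 < e -> exists2 z, ideal z & forall phi, char phi -> `|phi z - F phi| <= e) ->
  exists2 z, ideal z & forall phi, char phi -> phi z = F phi.
Proof.
move=> h.
have [r [r0 ndr rsmall]] : exists r : nat -> R, [/\ forall n, 0 < r n,
    forall n m, (n <= m)%N -> r m <= r n &
    forall e, 0 < e -> exists n, r n < e].
  exists (fun n => n.+1%:R^-1); split=> [n|n m nm|e e0].
  - by rewrite invr_gt0.
  - by rewrite lef_pV2 ?posrE// ler_nat.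
  - have [n _ hn] := near_infty_natSinv_lt (PosNum e0).
    by exists n; exact: (hn n (leqnn n)).
have {}h (n : nat) : exists z, ideal z /\
    forall phi, char phi -> `|phi z - F phi| <= r n.
  by have [//|z Iz hz] := h (r n); exists z.
have [z_ hz] := choice h.
have Iz n : ideal (z_ n) := (hz n).1.
have zF n phi : char phi -> `|phi (z_ n) - F phi| <= r n := (hz n).2 phi.
have Iu := pidealu lattE u0.
have Iru n : ideal ((2 * r n) *: u) by exact: pidealZ.
have dzm n m : (n <= m)%N ->
    z_ m - z_ n <=E (2 * r n) *: u /\ z_ n - z_ m <=E (2 * r n) *: u.
  move=> nm; have mn := ndr _ _ nm.
  have dphi phi : char phi -> `|phi (z_ m) - phi (z_ n)| <= 2 * r n.
    move=> chphi; have := zF n _ chphi; have := zF m _ chphi.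
    by rewrite !ler_norml => /andP[? ?] /andP[? ?]; apply/andP; split; lra.
  split; apply: (ble_char lattE u0); try exact: pidealB; try exact: Iru;
    move=> phi chphi; rewrite (lcharB chphi)// (lcharZ chphi)// (lcharu chphi) mulr1;
    by have := dphi _ chphi; rewrite ler_norml => /andP[? ?]; lra.
have ndz n m : (n <= m)%N -> `|z_ n - z_ m| <= 2 * r n * `|u|.
  move=> nm; have [h1 h2] := dzm _ _ nm.
  have e0 : 0 <= 2 * r n by rewrite mulr_ge0// ltW.
  rewrite -[X in X * `|u|]ger0_norm// -normrZ -(norm_lmod lattE (z_ n - z_ m)).
  apply: (ble_norm_pos lattE); first exact: lmod_ge0.
  by apply: ljoin_ble => //; rewrite opprB.
have /cauchy_cvgP cz : cauchy (z_ @ \oo).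
  apply: cauchy_exP => e e0.
  have [|n hn] := rsmall (e / (2 * (`|u| + 1))).
    by rewrite divr_gt0// mulr_gt0// ltr_wpDl.
  exists (z_ n); exists n => // m /= nm.
  rewrite -ball_normE /=; apply: le_lt_trans (ndz _ _ nm) _.
  move: hn; rewrite ltr_pdivlMr ?mulr_gt0 ?ltr_wpDl//.
  by have := normr_ge0 u; have := r0 n; nra.
pose z := lim (z_ @ \oo).
have zlim n : z - z_ n <=E (2 * r n) *: u /\ z_ n - z <=E (2 * r n) *: u.
  have hc e : 0 < e -> exists2 m, (n <= m)%N & `|z - z_ m| < e.
    move=> e0; have /cvgrPdist_lt/(_ _ e0)[N _ hN] := cz.
    exists (maxn n N); first exact: leq_maxl.
    by apply: hN => /=; exact: leq_maxr.
  split; apply: ble_closed => e /hc[m nm zm].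
    exists (z_ m - z_ n); first by have [] := dzm _ _ nm.
    by rewrite opprB addrA subrK.
  exists (z_ n - z_ m); first by have [] := dzm _ _ nm.
  rewrite distrC; move: zm; congr (`|_| < e).
  by rewrite opprB [z - _]addrC [RHS]addrC !addrA subrK addrC.
have Idz n : ideal (z - z_ n).
  by exists (2 * r n); rewrite opprB; exact: zlim.
have zI : ideal z by rewrite -(subrK (z_ 0) z); exact: pidealD.
exists z => // phi chphi; apply/eqP; rewrite -subr_eq0 -normr_le0.
apply/ler_addgt0Pr => e e0; rewrite add0r.
(* [phi z] is within 2 r n of [phi (z_ n)], which is within r n of [F phi]. *)
have [|n rn] := rsmall (e / 3); first by rewrite divr_gt0.
have [z1 z2] := zlim n.
have := lchar_le lattE chphi (Idz n) (Iru n) z1.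
have := lchar_le lattE chphi (pidealB lattE (Iz n) zI) (Iru n) z2.
rewrite !(lcharB chphi)// (lcharZ chphi)// (lcharu chphi) mulr1.
have := zF n _ chphi.
by rewrite !ler_norml => /andP[? ?] ? ?; apply/andP; split; lra.
Qed.

Section Approx.
Variables (f : R -> R -> R) (x y : E).
Hypotheses (fC : continuous (fun v : R * R => f v.1 v.2)) (Ix : ideal x) (Iy : ideal y).

(* The Pasch-Hausdorff minorant with slope [L] based at the point [P]. *)
Lemma local_minorant (C e : R) (P : R * R) : 0 < e ->
  (forall phi, char phi -> `|f (phi x) (phi y)| <= C) ->
  exists z (r : R), [/\ ideal z, 0 < r,
    forall phi, char phi -> phi z <= f (phi x) (phi y) &
    forall phi, char phi -> ball P r (phi x, phi y) -> f (phi x) (phi y) - e <= phi z].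
Proof.
move=> e0 fle.
have e30 : 0 < e / 3 by rewrite divr_gt0.
have /cvgrPdist_lt/(_ _ e30)/nbhs_ballP[rho /= rho0 hrho] := @fC P.
have {}hrho s t : `|P.1 - s| < rho -> `|P.2 - t| < rho ->
    `|f P.1 P.2 - f s t| < e / 3.
  by move=> h1 h2; apply: (hrho (s, t)); split; rewrite -ball_normE.
pose fP := f P.1 P.2.
(* The slope is chosen so that at distance [rho] from [P] the minorant has already dropped below -
   C, a lower bound of f on all characters. *)
pose L := (`|C| + `|fP|) / rho.
have L0 : 0 <= L by rewrite divr_ge0// ltW.
have Lrho : L * rho = `|C| + `|fP| by rewrite divfK// gt_eqF.
(* Within [r] the total loss is at most e: e / 3 from continuity, e / 3 from the offset in [z], e /
   3 from the slope. *)
pose r := Num.min rho (e / 3 / (2 * (L + 1))).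
have r0 : 0 < r by rewrite lt_min rho0 divr_gt0// mulr_gt0// ltr_wpDl.
have rrho : r <= rho by rewrite ge_min lexx.
have Lr : 2 * L * r <= e / 3.
  have : r <= e / 3 / (2 * (L + 1)) by rewrite ge_min lexx orbT.
  by rewrite ler_pdivlMr ?mulr_gt0 ?ltr_wpDl//; nra.
have Iu := pidealu lattE u0.
have Id1 : ideal (x - P.1 *: u) by apply: pidealB => //; exact: pidealZ.
have Id2 : ideal (y - P.2 *: u) by apply: pidealB => //; exact: pidealZ.
have IL := pidealD lattE (pideal_lmod lattE u0 Id1) (pideal_lmod lattE u0 Id2).
pose z := (fP - e / 3) *: u -
  L *: (lmod le (x - P.1 *: u) + lmod le (y - P.2 *: u)).
have zE phi : char phi ->
    phi z = fP - e / 3 - L * (`|P.1 - phi x| + `|P.2 - phi y|).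
  move=> chphi; rewrite /z (lcharB chphi); try exact: pidealZ.
  rewrite !(lcharZ chphi)// (lcharu chphi) mulr1 (lcharD chphi); try exact: pideal_lmod.
  rewrite !(lchar_lmod chphi)// !(lcharB chphi)//; try exact: pidealZ.
  by rewrite !(lcharZ chphi)// (lcharu chphi) !mulr1 ![`|phi _ - _|]distrC.
have fPC := ler_norm fP; have CC := ler_norm C; have C0 := normr_ge0 C.
exists z, r; split=> //.
- by apply: pidealB => //; exact: pidealZ.
- move=> phi chphi; rewrite zE//.
  have := fle _ chphi; rewrite ler_norml => /andP[fC1 _].
  set a := `|P.1 - phi x|; set b := `|P.2 - phi y|.
  have a0 : 0 <= a := normr_ge0 _; have b0 : 0 <= b := normr_ge0 _.
  have [ar|ar] := ltP a rho; last by nra.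
  have [br|br] := ltP b rho; last by nra.
  have := hrho _ _ ar br; rewrite ltr_norml -/fP => /andP[h1 h2].
  by have : 0 <= L * (a + b) by [rewrite mulr_ge0// addr_ge0]; lra.
- move=> phi chphi [/=]; rewrite -!ball_normE /= => ar br; rewrite zE//.
  have := hrho _ _ (lt_le_trans ar rrho) (lt_le_trans br rrho).
  rewrite ltr_norml -/fP => /andP[h1 h2].
  have : L * (`|P.1 - phi x| + `|P.2 - phi y|) <= e / 3.
    by apply: le_trans Lr; rewrite -mulrA mulrCA ler_wpM2l//; lra.
  by lra.
Qed.

(** Finitely many local minorants cover the compact square of possible values (phi x, phi y), and
    their join is a minorant within e of f, since characters turn joins into maxima. *)
Lemma calculus_approx (e : R) : 0 < e -> exists2 z, ideal z &
  forall phi, char phi -> `|phi z - f (phi x) (phi y)| <= e.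
Proof.
move=> e0; have Iu := pidealu lattE u0.
have [a a0 [xa Nxa]] := pideal_pos lattE u0 Ix.
have [b b0 [yb Nyb]] := pideal_pos lattE u0 Iy.
pose B : set (R * R) := `[- a, a] `*` `[- b, b].
have Bphi phi : char phi -> B (phi x, phi y).
  have bnd w c : ideal w -> w <=E c *: u -> - w <=E c *: u -> char phi ->
      phi w \in `[- c, c].
    move=> Iw wc Nwc chphi; rewrite in_itv /= -ler_norml.
    have := lchar_le lattE chphi Iw (pidealZ lattE u0 c Iu) wc.
    have := lchar_le lattE chphi (pidealN Iw) (pidealZ lattE u0 c Iu) Nwc.
    rewrite (lcharN chphi)// (lcharZ chphi)// (lcharu chphi) mulr1.
    by rewrite ler_norml => ? ?; apply/andP; split; lra.
  by move=> chphi; split; exact: bnd.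
have cB : compact B by apply: compact_setX; exact: segment_compact.
have [C fle] : exists C, forall phi, char phi -> `|f (phi x) (phi y)| <= C.
  have : compact [set f v.1 v.2 | v in B].
    by apply: continuous_compact => //; exact: continuous_subspaceT.
  move=> /compact_bounded[M [_ hM]]; exists (M + 1) => phi /Bphi Bp.
  by apply: (hM (M + 1)); [rewrite ltrDl|exists (phi x, phi y)].
pose cand := [set z | ideal z /\ forall phi, char phi -> phi z <= f (phi x) (phi y)].
(* The filter of sets containing all sufficiently large minorants, directed by joins. With
   compactness in its near-covering form it replaces the choice of a finite subcover. *)
pose F : set_system E := [set S | exists2 z0, cand z0 &
  forall z, cand z -> z0 <=E z -> S z].
have FF : Filter F.
  split.
  - exists ((- C) *: u) => //; split; first exact: pidealZ.
    move=> phi chphi; rewrite (lcharZ chphi)// (lcharu chphi) mulr1.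
    by have := fle _ chphi; rewrite ler_norml => /andP[].
  - move=> S T [z [Iz zle] zS] [w [Iw wle] wT]; exists (z \/E w).
      split; first exact: pidealJ.
      by move=> phi chphi; rewrite (lcharJ chphi)// ge_max zle//= wle.
    move=> v cv zwv; split; [apply: zS|apply: wT] => //.
      exact: (ble_trans lattE (ble_joinl lattE z w)).
    exact: (ble_trans lattE (ble_joinr lattE z w)).
  - by move=> S T ST [z cz zS]; exists z => // w cw zw; exact/ST/zS.
(* The condition is vacuous at points Q of the square that no character reaches. *)
pose good z := [set Q | forall phi, char phi -> (phi x, phi y) = Q ->
  f (phi x) (phi y) - e <= phi z].
have : F [set z | B `<=` good z].
  apply: ((@compact_near_coveringP _ B).1 cB E F good) => P _.
  have [z [r [Iz r0 zle zge]]] := local_minorant P e0 fle.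
  exists (ball P r, [set w | cand w /\ z <=E w]).
    split=> /=; first exact: nbhsx_ballx.
    by exists z.
  move=> [Q w] /= [PQ [[Iw wle] zw]] phi chphi Qphi.
  apply: le_trans (lchar_le lattE chphi Iz Iw zw).
  by apply: zge => //; rewrite Qphi.
move=> [z [Iz zle] /(_ z (conj Iz zle) (ble_refl lattE z)) zge].
exists z => // phi chphi; have := zle _ chphi => zle'.
rewrite ler_distl; apply/andP; split; last by lra.
exact: (zge _ (Bphi _ chphi)).
Qed.

End Approx.

Lemma calculus_exists f x y : continuous (fun v : R * R => f v.1 v.2) ->
  ideal x -> ideal y -> exists2 z, ideal z &
  forall phi, char phi -> phi z = f (phi x) (phi y).
Proof.
move=> fC Ix Iy; apply: (char_closed (F := fun phi => f (phi x) (phi y))).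
by move=> e e0; exact: calculus_approx.
Qed.

End Calculus.

(** * Krivine's calculus *)

Section H2.
Variable R : realType.
Implicit Types (f g : R -> R -> R) (a s t : R).

Lemma H2_fst : H2 (fun s t : R => s).
Proof. by split => // v; exact: cvg_fst. Qed.

Lemma H2_snd : H2 (fun s t : R => t).
Proof. by split => // v; exact: cvg_snd. Qed.

Lemma H2D f g : H2 f -> H2 g -> H2 (fun s t => f s t + g s t).
Proof.
move=> [fC fZ] [gC gZ]; split=> [v|a s t a0]; last by rewrite fZ// gZ// mulrDr.
by apply: cvgD; [exact: fC|exact: gC].
Qed.

Lemma H2Z a f : H2 f -> H2 (fun s t => a * f s t).
Proof.
move=> [fC fZ]; split=> [v|b s t b0]; last by rewrite fZ// mulrCA.
by apply: cvgMl_tmp; exact: fC.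
Qed.

Lemma H2norm f : H2 f -> H2 (fun s t => `|f s t|).
Proof.
move=> [fC fZ]; split=> [v|b s t b0]; last by rewrite fZ// normrM ger0_norm.
by apply: cvg_norm; exact: fC.
Qed.

Lemma H2_comp h f g : H2 h -> H2 f -> H2 g -> H2 (fun s t => h (f s t) (g s t)).
Proof.
move=> [hC hZ] [fC fZ] [gC gZ]; split=> [v|a s t a0]; last by rewrite fZ// gZ// hZ.
exact: (cvg_comp2 (h := h) (@fC v) (@gC v) (@hC (f v.1 v.2, g v.1 v.2))).
Qed.

Lemma H2max f g : H2 f -> H2 g -> H2 (fun s t => Num.max (f s t) (g s t)).
Proof.
move=> Hf Hg; have -> : (fun s t => Num.max (f s t) (g s t)) =
    fun s t => 2^-1 * (f s t + g s t + `|f s t + -1 * g s t|).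
  by apply/funext => s; apply/funext => t; rewrite mulN1r maxr_absE mulrC.
by apply: H2Z; apply: H2D; [exact: H2D|apply: H2norm; apply: H2D => //; exact: H2Z].
Qed.

Lemma H2_00 f : H2 f -> f 0 0 = 0.
Proof. by move=> [_ /(_ 0 0 0 (lexx _))]; rewrite !mul0r. Qed.

Lemma normD_le0 s t : `|s| + `|t| <= 0 -> s = 0 /\ t = 0.
Proof.
by move=> h; split; apply/normr0_eq0/eqP; rewrite eq_le normr_ge0 andbT;
  have := normr_ge0 s; have := normr_ge0 t; lra.
Qed.

(** Continuity at the origin gives |f| < 1 on a small ball; homogeneity spreads this bound to the
    plane. *)
Lemma H2_bound f : H2 f -> exists2 C, 0 <= C & forall s t, `|f s t| <= C * (`|s| + `|t|).
Proof.
move=> Hf; have [fC fZ] := Hf.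
have /cvgrPdist_lt/(_ _ ltr01)/nbhs_ballP[r /= r0 hr] := fC (0, 0).
have r20 : 0 < r / 2 by rewrite divr_gt0.
exists (r / 2)^-1; first by rewrite invr_ge0 ltW.
move=> s t; have [n0|n0] := leP (`|s| + `|t|) 0.
  have [s0 t0] := normD_le0 n0.
  by rewrite s0 t0 H2_00// normr0 addr0 mulr0.
set n := `|s| + `|t|; pose c := r / 2 / n; have c0 : 0 < c by rewrite divr_gt0.
have cn : c * n = r / 2 by rewrite divfK ?gt_eqF.
rewrite ler_pdivlMl// -cn mulrAC -[leRHS]mul1r ler_pM2r//.
rewrite -(gtr0_norm c0) -normrM -fZ ?(ltW c0)//.
have := hr (c * s, c * t); rewrite /= H2_00// sub0r normrN.
move=> h; apply/ltW/h; split; rewrite -ball_normE /= sub0r normrN normrM (gtr0_norm c0).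
  by apply: (@le_lt_trans _ _ (c * n)); [rewrite ler_pM2l// lerDl|rewrite cn; lra].
by apply: (@le_lt_trans _ _ (c * n)); [rewrite ler_pM2l// lerDr|rewrite cn; lra].
Qed.

(** The l^1 norm, written with [Num.max] and scalar multiples so that a homomorphism known only on
    sums, multiples and maxima can be pushed through it. *)
Definition l1 s t := Num.max s (-1 * s) + Num.max t (-1 * t).

Lemma l1E s t : l1 s t = `|s| + `|t|.
Proof. by rewrite /l1 !mulN1r !maxrN. Qed.

Lemma H2_l1 : H2 l1.
Proof.
by apply: H2D; apply: H2max; try apply: H2Z; first [exact: H2_fst|exact: H2_snd].
Qed.

(* [f] is close to [f P] times the norm near the ray through [P]; away from that
   ray the second term dominates. *)
Lemma H2_ray_bound f (p q e : R) : H2 f -> 0 < `|p| + `|q| -> 0 < e ->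
  exists2 L, 0 <= L & forall s t, let r := `|p| + `|q| in
    `|r * f s t - f p q * l1 s t| <=
      e * l1 s t + L * l1 (r * s - p * l1 s t) (r * t - q * l1 s t).
Proof.
move=> Hf r0 e0; have [fC fZ] := Hf; set r := `|p| + `|q|.
have /cvgrPdist_lt/(_ _ e0)/nbhs_ballP[d /= d0 hd] := fC (p, q).
have [C C0 fle] := H2_bound Hf.
(* At distance [d] from (p, q) the second term is then at least 2 C r, which bounds |f s' t'| + |f p
   q| on the l^1 sphere of radius r. *)
pose L := 2 * C * r / d.
have L0 : 0 <= L by rewrite divr_ge0 ?mulr_ge0// ltW.
exists L => // s t /=; rewrite !l1E -/r; set n := `|s| + `|t|.
have [n0|n0] := leP n 0.
  have n00 : n = 0 by apply/eqP; rewrite eq_le n0 addr_ge0.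
  have := fle s t; rewrite -/n n00 mulr0 normr_le0 => /eqP ->.
  by rewrite !mulr0 subrr normr0 add0r mulr_ge0// addr_ge0.
pose c := n / r; have c0 : 0 < c by rewrite divr_gt0.
(* By homogeneity everything is compared on the l^1 sphere through (p, q). *)
pose s' := r / n * s; pose t' := r / n * t.
have rn0 : 0 < r / n by rewrite divr_gt0.
have nfs : r * f s t = n * f s' t'.
  by rewrite fZ ?ltW// mulrA [n * _]mulrC divfK ?gt_eqF.
have ns' : r * s = n * s' by rewrite mulrA [n * _]mulrC divfK ?gt_eqF.
have nt' : r * t = n * t' by rewrite mulrA [n * _]mulrC divfK ?gt_eqF.
have n's' : `|s'| + `|t'| = r.
  by rewrite (normrM _ s) (normrM _ t) (gtr0_norm rn0) -mulrDr divfK ?gt_eqF.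
rewrite nfs ns' nt' [f p q * n]mulrC [p * n]mulrC [q * n]mulrC -!mulrBr !normrM.
rewrite (gtr0_norm n0) -mulrDr [e * n]mulrC mulrCA -mulrDr ler_pM2l//.
have [hs|hs] := ltP `|s' - p| d; last first.
  have := fle s' t'; have := fle p q; rewrite n's' -/r => h1 h2.
  apply: (le_trans (ler_normB _ _)).
  have : L * d <= L * (`|s' - p| + `|t' - q|).
    by rewrite ler_wpM2l//; have := normr_ge0 (t' - q); lra.
  by rewrite divfK ?gt_eqF//; lra.
have [ht|ht] := ltP `|t' - q| d; last first.
  have := fle s' t'; have := fle p q; rewrite n's' -/r => h1 h2.
  apply: (le_trans (ler_normB _ _)).
  have : L * d <= L * (`|s' - p| + `|t' - q|).
    by rewrite ler_wpM2l//; have := normr_ge0 (s' - p); lra.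
  by rewrite divfK ?gt_eqF//; lra.
have := hd (s', t'); rewrite distrC => /(_ _)/ltW.
have : 0 <= L * (`|s' - p| + `|t' - q|) by rewrite mulr_ge0// addr_ge0.
move=> ? h; have := h; rewrite /=; move=> {}h.
apply: (@le_trans _ _ e); last by lra.
by apply: h; split; rewrite -ball_normE /= distrC.
Qed.

(** * Rigidity: real homomorphisms on homogeneous functions are point evaluations *)

Section RealHom.
Variable psi : (R -> R -> R) -> R.
Hypotheses
  (psiD : forall f g, H2 f -> H2 g -> psi (fun s t => f s t + g s t) = psi f + psi g)
  (psiZ : forall a f, H2 f -> psi (fun s t => a * f s t) = a * psi f)
  (psiM : forall f g, H2 f -> H2 g ->
     psi (fun s t => Num.max (f s t) (g s t)) = Num.max (psi f) (psi g)).

Let p := psi (fun s t => s).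
Let q := psi (fun s t => t).

Lemma real_hom_le f g : H2 f -> H2 g -> (forall s t, f s t <= g s t) -> psi f <= psi g.
Proof.
move=> Hf Hg fg; have := psiM Hf Hg.
have -> : (fun s t => Num.max (f s t) (g s t)) = g.
  by apply/funext => s; apply/funext => t; exact/max_idPr.
by move=> ->; rewrite le_max lexx.
Qed.

Lemma real_hom_l1 f g : H2 f -> H2 g ->
  psi (fun s t => l1 (f s t) (g s t)) = l1 (psi f) (psi g).
Proof.
move=> Hf Hg; have HN h : H2 h -> H2 (fun s t => -1 * h s t) := @H2Z (-1) h.
have HM h : H2 h -> H2 (fun s t => Num.max (h s t) (-1 * h s t)).
  by move=> Hh; apply: H2max => //; exact: HN.
have Hpsi h : H2 h ->
    psi (fun s t => Num.max (h s t) (-1 * h s t)) = Num.max (psi h) (-1 * psi h).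
  by move=> Hh; rewrite (psiM Hh (HN _ Hh)) psiZ.
by rewrite /l1 (psiD (HM _ Hf) (HM _ Hg)) !Hpsi.
Qed.

Lemma real_hom_norm_le f g : H2 f -> H2 g -> (forall s t, `|f s t| <= g s t) ->
  `|psi f| <= psi g.
Proof.
move=> Hf Hg fg; rewrite ler_norml; apply/andP; split.
  rewrite lerNl -mulN1r -psiZ//; apply: real_hom_le => //; first exact: H2Z.
  by move=> s t; have := fg s t; rewrite mulN1r lerNl ler_norml => /andP[].
by apply: real_hom_le => // s t; apply: le_trans (fg s t); exact: ler_norm.
Qed.

Lemma real_hom_eval f : H2 f -> psi f = f p q.
Proof.
move=> Hf; pose r := `|p| + `|q|.
have psil1 : psi l1 = r by rewrite (real_hom_l1 H2_fst H2_snd) l1E.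
have Hl1 := H2_l1.
have [r0|r0] := leP r 0.
  have [p0 q0] := normD_le0 r0.
  have [C C0 fle] := H2_bound Hf.
  have : `|psi f| <= psi (fun s t => C * l1 s t).
    by apply: real_hom_norm_le => //; [exact: H2Z|move=> s t; rewrite l1E].
  rewrite psiZ// psil1 p0 q0 H2_00// => h; apply/eqP.
  by rewrite -normr_le0 (le_trans h)// mulr_ge0_le0.
suff : r * psi f = r * f p q by move=> /mulfI; apply; rewrite gt_eqF.
apply/eqP; rewrite -subr_eq0 -normr_le0; apply/ler_addgt0Pr => e e0; rewrite add0r.
have e'0 : 0 < e / r by rewrite divr_gt0.
have [L L0 hL] := H2_ray_bound Hf r0 e'0.
have HB (c a : R) g : H2 g -> H2 (fun s t => c * g s t + a * l1 s t).
  by move=> Hg; apply: H2D; exact: H2Z.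
have psiB (c a : R) g : H2 g -> psi (fun s t => c * g s t + a * l1 s t) = c * psi g + a * r.
  by move=> Hg; rewrite psiD ?psiZ ?psil1//; exact: H2Z.
pose k1 s t := r * s + - p * l1 s t; pose k2 s t := r * t + - q * l1 s t.
have Hk1 : H2 k1 := HB _ _ _ H2_fst; have Hk2 : H2 k2 := HB _ _ _ H2_snd.
have Hk : H2 (fun s t => l1 (k1 s t) (k2 s t)) by exact: H2_comp.
have k10 : psi k1 = 0 by rewrite (psiB _ _ _ H2_fst) -/p; ring.
have k20 : psi k2 = 0 by rewrite (psiB _ _ _ H2_snd) -/q; ring.
have : `|psi (fun s t => r * f s t + - f p q * l1 s t)| <=
    psi (fun s t => e / r * l1 s t + L * l1 (k1 s t) (k2 s t)).
  apply: real_hom_norm_le; [exact: HB|by apply: H2D; exact: H2Z|].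
  by move=> s t; have := hL s t; rewrite /= -/r /k1 /k2 !mulNr.
rewrite psiB// psiD; try exact: H2Z.
rewrite !psiZ// psil1 real_hom_l1// k10 k20 l1E normr0 addr0 mulr0 addr0.
by rewrite divfK ?gt_eqF// mulNr [r * f _ _]mulrC.
Qed.

End RealHom.
End H2.

Section Krivine.
Variables (R : realType) (E : completeNormedModType R) (le : E -> E -> Prop).
Hypothesis lattE : banach_lattice le.
Implicit Types (x y z w : E) (a b c e : R) (f g : R -> R -> R).

Local Notation "x <=E y" := (le x y) (at level 70, y at next level).

(** In the ideal of |x| + |y|, Phi f is the element whose value at each character phi is f (phi x)
    (phi y). Characters separate points, so it is unique and the homomorphism laws reduce to scalar
    identities. *)
Lemma lattice_hom_exists x y : exists Phi, [/\ lattice_hom2 le Phi,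
  Phi (fun s t => s) = x & Phi (fun s t => t) = y].
Proof.
pose u := lmod le x + lmod le y; have u0 : 0 <=E u := lmodD_ge0 lattE x y.
have Ix : pideal le u x.
  apply: (pideal_ble lattE); rewrite -[X in le X _]addr0.
  by apply: bleD (lmod_ge0 lattE y) => //; exact: ble_refl.
have Iy : pideal le u y.
  apply: (pideal_ble lattE); rewrite -[X in le X _]add0r.
  by apply: bleD => //; [exact: lmod_ge0|exact: ble_refl].
pose spec f z := pideal le u z /\
  forall phi, lattice_char le u phi -> phi z = f (phi x) (phi y).
pose Phi f : E := xget 0 [set z | spec f z].
have PhiE f z : spec f z -> Phi f = z.
  move=> sz; have [Iw w_spec] : spec f (Phi f).
    by apply: (@xgetPex _ 0 [set z | spec f z]); exists z.
  have [Iz z_spec] := sz.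
  by apply: (beq_char lattE u0) => // phi chphi; rewrite w_spec// z_spec.
have PhiP f : H2 f -> spec f (Phi f).
  move=> [fC _]; have [z Iz hz] := calculus_exists lattE u0 fC Ix Iy.
  by rewrite (@PhiE _ z).
exists Phi; split; [|exact: PhiE|exact: PhiE].
move=> f g /PhiP[If fE] /PhiP[Ig gE]; split.
- apply: PhiE; split; first exact: pidealD.
  by move=> phi chphi; rewrite (lcharD chphi)// fE// gE.
- move=> a; apply: PhiE; split; first exact: pidealZ.
  by move=> phi chphi; rewrite (lcharZ chphi)// fE.
- apply: PhiE; split; first exact: pidealJ.
  by move=> phi chphi; rewrite (lcharJ chphi)// fE// gE.
Qed.

Section Eval.
Variable Phi : (R -> R -> R) -> E.
Hypothesis hPhi : lattice_hom2 le Phi.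

Lemma lattice_hom_le f g : H2 f -> H2 g -> (forall s t, f s t <= g s t) ->
  Phi f <=E Phi g.
Proof.
move=> Hf Hg fg; have [_ _] := hPhi Hf Hg.
have -> : (fun s t => Num.max (f s t) (g s t)) = g.
  by apply/funext => s; apply/funext => t; exact/max_idPr.
by move=> ->; exact: ble_joinl.
Qed.

(** Here [Phi] is an arbitrary homomorphism, not the constructed one. It stays in the ideal because
    |f| <= C l1 and [l1] is built from the projections by lattice operations. *)
Lemma lattice_hom_pideal u f : 0 <=E u ->
  pideal le u (Phi (fun s t => s)) -> pideal le u (Phi (fun s t => t)) ->
  H2 f -> pideal le u (Phi f).
Proof.
move=> u0 Ix Iy Hf.
have PhiZ a g (Hg : H2 g) : Phi (fun s t => a * g s t) = a *: Phi g.
  by have [_ + _] := hPhi Hg Hg; exact.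
have Il1 : pideal le u (Phi (@l1 R)).
  have PhiJ g : H2 g -> Phi (fun s t => Num.max (g s t) (-1 * g s t)) =
      ljoin le (Phi g) (-1 *: Phi g).
    by move=> Hg; have [_ _ ->] := hPhi Hg (H2Z (-1) Hg); rewrite PhiZ.
  have HJ g : H2 g -> H2 (fun s t => Num.max (g s t) (-1 * g s t)).
    by move=> Hg; apply: H2max => //; exact: H2Z.
  have [-> _ _] := hPhi (HJ _ (@H2_fst R)) (HJ _ (@H2_snd R)).
  rewrite !PhiJ; try exact: H2_fst; try exact: H2_snd.
  by apply: pidealD => //; apply: pidealJ => //; exact: pidealZ.
have [C C0 fle] := H2_bound Hf.
have Hl1 := @H2_l1 R.
have Hw := H2Z C Hl1; pose w := Phi (fun s t => C * l1 s t).
have [a [wa _]] : pideal le u w by rewrite /w PhiZ//; exact: pidealZ.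
exists a; split; apply: (ble_trans lattE _ wa).
  by apply: lattice_hom_le => // s t; rewrite l1E (le_trans (ler_norm _)).
rewrite -scaleN1r -PhiZ//; apply: lattice_hom_le => //; first exact: H2Z.
by move=> s t; rewrite l1E mulN1r (le_trans (ler_norm _))// normrN.
Qed.

(** The composite of phi with Phi is a real homomorphism, so [real_hom_eval] applies; in particular
    all homomorphisms with the same projections agree on [H2]. *)
Lemma lattice_hom_char u f phi : 0 <=E u ->
  pideal le u (Phi (fun s t => s)) -> pideal le u (Phi (fun s t => t)) ->
  lattice_char le u phi -> H2 f ->
  phi (Phi f) = f (phi (Phi (fun s t => s))) (phi (Phi (fun s t => t))).
Proof.
move=> u0 Ix Iy chphi Hf.
have Ih g : H2 g -> pideal le u (Phi g) := lattice_hom_pideal u0 Ix Iy.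
apply: (@real_hom_eval _ (fun f => phi (Phi f))) => //.
- by move=> g h Hg Hh; have [-> _ _] := hPhi Hg Hh; rewrite (lcharD chphi)//; exact: Ih.
- move=> a g Hg; have [_ -> _] := hPhi Hg Hg; rewrite (lcharZ chphi)//; exact: Ih.
- by move=> g h Hg Hh; have [_ _ ->] := hPhi Hg Hh; rewrite (lcharJ chphi)//; exact: Ih.
Qed.

End Eval.

(** The homomorphism may vary with f, which is harmless once values are read through characters. *)
Lemma krivine2_spec f x y : exists Phi, [/\ lattice_hom2 le Phi,
  Phi (fun s t => s) = x, Phi (fun s t => t) = y & Phi f = krivine2 le f x y].
Proof.
pose S := [set z | exists Phi, [/\ lattice_hom2 le Phi,
  Phi (fun s t => s) = x, Phi (fun s t => t) = y & Phi f = z]].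
have [Phi [h1 h2 h3]] := lattice_hom_exists x y.
by apply: (@xgetPex _ 0 S); exists (Phi f), Phi.
Qed.

Lemma pideal_krivine2 u f x y : 0 <=E u -> H2 f ->
  pideal le u x -> pideal le u y -> pideal le u (krivine2 le f x y).
Proof.
move=> u0 Hf; have [Phi [hPhi <- <- <-]] := krivine2_spec f x y.
by move=> Ix Iy; exact: (lattice_hom_pideal hPhi).
Qed.

Lemma lchar_krivine2 u f x y phi : 0 <=E u -> H2 f ->
  pideal le u x -> pideal le u y -> lattice_char le u phi ->
  phi (krivine2 le f x y) = f (phi x) (phi y).
Proof.
move=> u0 Hf; have [Phi [hPhi <- <- <-]] := krivine2_spec f x y.
by move=> Ix Iy chphi; exact: (lattice_hom_char hPhi u0).
Qed.

End Krivine.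

(** * Integrals over a period *)

Section Periodic.
Variable R : realType.
Local Notation mu := (@lebesgue_measure R).
Implicit Types (N : R -> R) (a b c : R).

Lemma integrable_continuous_itv N a b : continuous N ->
  mu.-integrable `[a, b] (EFin \o N).
Proof.
move=> NC; apply: continuous_compact_integrable; first exact: segment_compact.
exact: continuous_subspaceT.
Qed.

Lemma Rintegral_shift N c a b : a < b -> continuous N ->
  \int[mu]_(x in `[a + c, b + c]) N x = \int[mu]_(x in `[a, b]) N (x + c).
Proof.
move=> ab NC.
have dF x : is_derive x (1 : R) (fun x : R => x + c) 1.
  by apply: (is_derive_eq (is_deriveD (is_derive_id _ _) (is_derive_cst _ _ _))); rewrite addr0.
have F'E : (fun x : R => x + c)^`()%classic = cst 1.
  by apply/funext => x; rewrite derive1E; exact: derive_val.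
rewrite /Rintegral; congr fine.
rewrite (@integration_by_substitution_increasing _ (fun x => x + c) N)//.
- by apply: eq_integral => x _; rewrite F'E /= mulr1.
- exact: ltW.
- by move=> x y _ _; rewrite ltrD2r.
- by rewrite F'E => x _; exact: cst_continuous.
- by rewrite F'E; exact: is_cvg_cst.
- by rewrite F'E; exact: is_cvg_cst.
- have FC : continuous (fun x : R => x + c).
    by move=> x; apply: cvgD; [exact: cvg_id|exact: cvg_cst].
  split.
  + by move=> x _; have [] := dF x.
  + by apply: cvg_at_right_filter; exact: FC.
  + by apply: cvg_at_left_filter; exact: FC.
- exact: continuous_subspaceT.
Qed.

Lemma Rintegral_itv_split N a b c : a <= b -> b <= c -> continuous N ->
  \int[mu]_(x in `[a, c]) N x = \int[mu]_(x in `[a, b]) N x + \int[mu]_(x in `[b, c]) N x.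
Proof.
move=> ab bc NC.
have := @Rintegral_itvB _ N (BLeft a) (BRight c) b (integrable_continuous_itv a c NC).
rewrite !bnd_simp => /(_ ab bc); rewrite (@Rintegral_itv_obnd_cbnd _ b).
  by move=> <-; rewrite addrC subrK.
apply: integrableS (integrable_continuous_itv b c NC) => //.
exact: subset_itv_oc_cc.
Qed.

Lemma Rintegral_itv_cst a b c : a <= b -> \int[mu]_(x in `[a, b]) c = c * (b - a).
Proof.
move=> ab; rewrite Rintegral_cst//= lebesgue_measure_itv /= lte_fin.
case: ltgtP ab => [//|//|->] _; by rewrite ?subrr.
Qed.

(** The integral is folded onto [0, pi / 2], where the four translates add up to at least 4 c. *)
Lemma Rintegral_quarters_ge N c : continuous N ->
  (forall x, 4 * c <= N x + N (x + pi / 2) + N (x + pi) + N (x + 3 * pi / 2)) ->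
  c * (2 * pi) <= \int[mu]_(x in `[0, 2 * pi]) N x.
Proof.
move=> NC Nge; have pi0 : 0 < pi :> R := pi_gt0 R.
have NCs d : continuous (fun x => N (x + d)).
  move=> x; apply: (@continuous_comp _ _ _ (fun x => x + d) N); last exact: NC.
  by apply: cvgD; [exact: cvg_id|exact: cvg_cst].
have L0 : 0 < pi / 2 :> R by rewrite divr_gt0.
have quarter d d' : d' = pi / 2 + d ->
    \int[mu]_(x in `[d, d']) N x = \int[mu]_(x in `[0, pi / 2]) N (x + d).
  by move=> ->; rewrite -Rintegral_shift// add0r.
rewrite (@Rintegral_itv_split _ _ (pi / 2))//; [|lra|lra].
rewrite (@Rintegral_itv_split _ (pi / 2) pi)//; [|lra|lra].
rewrite (@Rintegral_itv_split _ pi (3 * pi / 2))//; [|lra|lra].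
rewrite (@quarter (pi / 2)) ?(@quarter pi) ?(@quarter (3 * pi / 2)); [|lra|lra|lra].
have int d : mu.-integrable `[0, pi / 2] (EFin \o (fun x => N (x + d))).
  exact: integrable_continuous_itv.
have int2 f g : mu.-integrable `[0, pi / 2] (EFin \o f) ->
    mu.-integrable `[0, pi / 2] (EFin \o g) ->
    mu.-integrable `[0, pi / 2] (EFin \o (fun x => f x + g x)).
  by move=> hf hg; apply: (integrableD _ hf hg).
have int0 : mu.-integrable `[0, pi / 2] (EFin \o N) by exact: integrable_continuous_itv.
have i2 := int2 _ _ int0 (int (pi / 2)); have i3 := int2 _ _ i2 (int pi).
have i4 := int2 _ _ i3 (int (3 * pi / 2)).
rewrite !addrA -!RintegralD//.
have -> : c * (2 * pi) = \int[mu]_(x in `[0, pi / 2]) (4 * c).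
  by rewrite Rintegral_itv_cst ?ltW//; lra.
apply: le_Rintegral => //.
by apply: integrable_continuous_itv => x; exact: cst_continuous.
Qed.

End Periodic.

(** * Homogeneous estimates *)

Section Powers.
Variable R : realType.
Implicit Types (a b c p q s t x : R) (f g k : R -> R -> R).

Lemma continuous_compT (T : topologicalType) (h : T -> R) (g : R -> R) :
  continuous h -> continuous g -> continuous (fun w => g (h w)).
Proof. by move=> hC gC w; exact: (continuous_comp (@hC w) (@gC (h w))). Qed.

Let fstC : continuous (fun v : R * R => v.1). Proof. by move=> v; exact: cvg_fst. Qed.
Let sndC : continuous (fun v : R * R => v.2). Proof. by move=> v; exact: cvg_snd. Qed.

Lemma powR_norm_continuous p : 0 < p -> continuous (fun x : R => `|x| `^ p).
Proof.
move=> p0 x; have [->|x0] := eqVneq x 0.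
  rewrite /continuous_at normr0 powR0 ?gt_eqF//.
  apply/cvgrPdist_lt => e e0; apply/nbhs_ballP; exists (e `^ p^-1) => /=.
    exact: powR_gt0.
  move=> y /=; rewrite sub0r normrN => ye.
  rewrite sub0r normrN ger0_norm ?powR_ge0//.
  have <- : (e `^ p^-1) `^ p = e.
    by rewrite -powRrM mulVf ?gt_eqF// powRr1// ltW.
  by apply: gt0_ltr_powR => //; rewrite nnegrE ?powR_ge0.
apply: (@continuous_comp _ _ _ (fun x : R => `|x|) (fun y : R => y `^ p)).
  by apply: cvg_norm; exact: cvg_id.
apply: differentiable_continuous; apply/derivable1_diffP.
by apply: derivable_powR; rewrite in_itv /= andbT normr_gt0.
Qed.

Lemma powR_le p a b : 0 <= p -> 0 <= a -> a <= b -> a `^ p <= b `^ p.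
Proof.
move=> p0 a0 ab; apply: ge0_ler_powR => //; rewrite nnegrE//.
exact: le_trans ab.
Qed.

Lemma powRK p x : 0 <= x -> p != 0 -> (x `^ p) `^ p^-1 = x.
Proof. by move=> x0 p0; rewrite -powRrM mulfV// powRr1. Qed.

Lemma powRVK p x : 0 <= x -> p != 0 -> (x `^ p^-1) `^ p = x.
Proof. by move=> x0 p0; rewrite -powRrM mulVf// powRr1. Qed.

Lemma spow_ge0E p x : 0 <= x -> p != 0 -> spow x p = x `^ p.
Proof.
rewrite le_eqVlt /spow => /predU1P[<-|x0] p0.
  by rewrite sgr0 mul0r powR0.
by rewrite gtr0_sg// mul1r gtr0_norm.
Qed.

Lemma spowN p x : spow (- x) p = - spow x p.
Proof. by rewrite /spow sgrN normrN mulNr. Qed.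

Lemma norm_spow p x : p != 0 -> `|spow x p| = `|x| `^ p.
Proof.
move=> p0; have [x0|x0] := leP 0 x.
  by rewrite spow_ge0E// ger0_norm ?powR_ge0// ger0_norm.
rewrite -[x]opprK spowN !normrN spow_ge0E ?oppr_ge0 ?ltW//.
by rewrite ger0_norm ?powR_ge0// ltr0_norm.
Qed.

(** The sign jumps at 0, so the signed power is rewritten as the difference of the powers of the
    positive and negative parts. *)
Lemma spow_continuous p : 0 < p -> continuous (fun x : R => spow x p).
Proof.
move=> p0.
have -> : (fun x : R => spow x p) =
    fun x : R => `|Num.max x 0| `^ p - `|Num.max (- x) 0| `^ p.
  apply/funext => x; have pn0 : p != 0 by rewrite gt_eqF.
  have [x0|x0] := leP 0 x.
    by rewrite spow_ge0E// (max_idPr _) ?oppr_le0// normr0 powR0// subr0 ger0_norm.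
  rewrite -[in LHS](opprK x) spowN spow_ge0E ?oppr_ge0 ?ltW//.
  rewrite (max_idPl _) ?oppr_ge0 ?(ltW x0)//.
  by rewrite normr0 powR0// sub0r ger0_norm// oppr_ge0 ltW.
have maxC : continuous (fun x : R => Num.max x 0).
  move=> x; have -> : (fun x : R => Num.max x 0) = fun x => 2^-1 * (x + `|x|).
    by apply/funext => y; rewrite maxr_absE addr0 subr0 mulrC.
  by apply: cvgMl_tmp; apply: cvgD; [exact: cvg_id|apply: cvg_norm; exact: cvg_id].
have powC := powR_norm_continuous p0.
have NC : continuous (fun x : R => - x) by move=> x; apply: cvgN; exact: cvg_id.
move=> x; apply: cvgB; first exact: (continuous_compT maxC powC).
exact: (continuous_compT (continuous_compT NC maxC) powC).
Qed.

Lemma spowM p a x : 0 <= a -> p != 0 -> spow (a * x) p = a `^ p * spow x p.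
Proof.
rewrite le_eqVlt => /predU1P[<-|a0] p0.
  by rewrite mul0r /spow sgr0 mul0r powR0// mul0r.
by rewrite /spow sgrM gtr0_sg// mul1r normrM gtr0_norm// powRM// ?ltW// mulrCA.
Qed.

Lemma spowK p x : p != 0 -> spow (spow x p) p^-1 = x.
Proof.
move=> p0; have pV0 : p^-1 != 0 by rewrite invr_eq0.
wlog x0 : x / 0 <= x => [h|]; last by rewrite !spow_ge0E ?powR_ge0// powRK.
have [x0|x0] := leP 0 x; first exact: h.
by have := h (- x); rewrite !spowN oppr_ge0 => /(_ (ltW x0))/oppr_inj.
Qed.

Lemma spowVK p x : p != 0 -> spow (spow x p^-1) p = x.
Proof. by move=> p0; rewrite -{2}[p]invrK spowK// invr_eq0. Qed.

(** * Scalar inequalities for q-sums and p-addition *)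

Definition paddr p s t := spow (spow s p^-1 + spow t p^-1) p.

Lemma H2_paddr p : 0 < p -> H2 (paddr p).
Proof.
move=> p0; have pV0 : 0 < p^-1 by rewrite invr_gt0.
have pn0 : p != 0 by rewrite gt_eqF.
split=> [v|a s t a0].
  apply: (continuous_compT (h := fun v : R * R => spow v.1 p^-1 + spow v.2 p^-1)
    _ (spow_continuous p0)) => w.
  have sC := spow_continuous pV0.
  by apply: cvgD; [exact: (continuous_compT fstC sC)|exact: (continuous_compT sndC sC)].
rewrite /paddr !spowM ?invr_eq0// -mulrDr spowM ?powR_ge0//.
by rewrite powRVK.
Qed.

Lemma H2_qsum q : 0 < q -> H2 (qsum q).
Proof.
move=> q0; have qV0 : 0 < q^-1 by rewrite invr_gt0.
have qn0 : q != 0 by rewrite gt_eqF.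
have sum0 s t : 0 <= `|s| `^ q + `|t| `^ q by rewrite addr_ge0 ?powR_ge0.
split=> [v|a s t a0].
  have -> : (fun v : R * R => qsum q v.1 v.2) =
      fun v => `| `|v.1| `^ q + `|v.2| `^ q| `^ q^-1.
    by apply/funext => w; rewrite ger0_norm.
  apply: (continuous_compT (h := fun v : R * R => `|v.1| `^ q + `|v.2| `^ q)
    _ (powR_norm_continuous qV0)) => w.
  have qC := powR_norm_continuous q0.
  by apply: cvgD; [exact: (continuous_compT fstC qC)|exact: (continuous_compT sndC qC)].
rewrite /qsum !normrM !(ger0_norm a0) !powRM// -mulrDr powRM ?powR_ge0//.
by rewrite powRK.
Qed.

Lemma qsum1 s t : qsum 1 s t = `|s| + `|t|.
Proof. by rewrite /qsum invr1 !powRr1// addr_ge0. Qed.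

Lemma qsum_ge0 q s t : 0 <= qsum q s t. Proof. exact: powR_ge0. Qed.

(** The shares |s| / n and |t| / n of n = |s| + |t| lie in [0, 1], so raising them to the power q
    decreases them, and they add up to 1. *)
Lemma qsum_le q s t : 1 <= q -> qsum q s t <= `|s| + `|t|.
Proof.
move=> q1; have q0 : 0 < q by lra.
have qn0 : q != 0 by rewrite gt_eqF.
set n := `|s| + `|t|; have n0 : 0 <= n by rewrite addr_ge0.
rewrite -[leRHS](powRK n0 qn0) /qsum; apply: ge0_ler_powR.
- by rewrite invr_ge0 ltW.
- by rewrite nnegrE addr_ge0 ?powR_ge0.
- by rewrite nnegrE powR_ge0.
move: n0; rewrite le_eqVlt => /predU1P[n0|n0].
  have [-> ->] : s = 0 /\ t = 0 by apply: normD_le0; rewrite -/n -n0.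
  by rewrite -n0 normr0 powR0// addr0.
have frac x : 0 <= x -> x <= n -> x `^ q <= n `^ q * (x / n).
  move=> x0 xn; have [->|xp] := eqVneq x 0; first by rewrite powR0// mul0r mulr0.
  have xpos : 0 < x by rewrite lt_neqAle eq_sym xp.
  have -> : x `^ q = n `^ q * (x / n) `^ q.
    by rewrite -powRM ?divr_ge0 ?ltW// mulrCA divff ?mulr1// gt_eqF.
  rewrite ler_pM2l ?powR_gt0//; apply: ge1r_powR => //.
  by rewrite divr_gt0//= ler_pdivrMr// mul1r.
have := frac `|s| (normr_ge0 s); have := frac `|t| (normr_ge0 t).
rewrite lerDl lerDr !normr_ge0 => /(_ isT) h1 /(_ isT) h2.
apply: le_trans (lerD h2 h1) _.
by rewrite -mulrDr -mulrDl divff ?mulr1 ?gt_eqF.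
Qed.

(** With x = e^y, the bound e^((p-1)y) >= 1 + (p-1) y gives x^p >= x + (p-1) x y, and 1 - y < e^(-y)
    gives x y > x - 1. *)
Lemma bernoulli_lt p x : 1 < p -> 0 <= x -> x != 1 -> 1 + p * (x - 1) < x `^ p.
Proof.
move=> p1; rewrite le_eqVlt => /predU1P[<-|x0] x1.
  by rewrite powR0 ?gt_eqF//; lra.
have [y xE] : exists y, x = expR y by exists (ln x); rewrite lnK// posrE.
have y0 : y != 0 by apply: contra_neq x1; rewrite xE => ->; rewrite expR0.
have -> : x `^ p = expR y * expR ((p - 1) * y).
  by rewrite /powR gt_eqF// xE expRK -expRD; congr expR; ring.
have h1 := expR_ge1Dx ((p - 1) * y).
have h2 : 1 - y < expR (- y) by apply: expR_gt1Dx; rewrite oppr_eq0.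
have h3 : expR y * expR (- y) = 1 by rewrite -expRD subrr expR0.
have h4 : expR y * (1 - y) < 1 by rewrite -[ltRHS]h3 ltr_pM2l ?expR_gt0.
have h5 : expR y * (1 + (p - 1) * y) <= expR y * expR ((p - 1) * y).
  by rewrite ler_pM2l ?expR_gt0.
by rewrite xE; nra.
Qed.

Lemma bernoulli_le p x : 1 < p -> 0 <= x -> 1 + p * (x - 1) <= x `^ p.
Proof.
move=> p1 x0; have [->|x1] := eqVneq x 1; first by rewrite powR1 subrr mulr0 addr0.
exact/ltW/bernoulli_lt.
Qed.

(** After division by |a| the Bernoulli tangent at 1 applies to |1 + v| and |1 - v|, whose sum is at
    least 2; strictness holds because they cannot both equal 1 when v is nonzero. *)
Lemma powR_midpoint_lt p a b : 1 < p -> b != 0 ->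
  `|a| `^ p < 2^-1 * (`|a + b| `^ p + `|a - b| `^ p).
Proof.
move=> p1 b0; have pn0 : p != 0 by rewrite gt_eqF//; lra.
have [->|a0] := eqVneq a 0.
  rewrite normr0 powR0// add0r sub0r normrN mulr_gt0// addr_gt0//;
    by rewrite powR_gt0// normr_gt0.
have na : 0 < `|a| by rewrite normr_gt0.
pose v := b / a; have v0 : v != 0 by rewrite mulf_neq0// invr_eq0.
have -> : `|a + b| = `|a| * `|1 + v|.
  by rewrite -normrM mulrDr mulr1 /v mulrCA divff// mulr1.
have -> : `|a - b| = `|a| * `|1 - v|.
  by rewrite -normrM mulrBr mulr1 /v mulrCA divff// mulr1.
rewrite !powRM// -mulrDr mulrCA -[ltLHS]mulr1 ltr_pM2l ?powR_gt0//.
have h2 : 2 <= `|1 + v| + `|1 - v|.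
  by apply: le_trans (ler_normD _ _); rewrite (_ : 1 + v + (1 - v) = 2) ?ger0_norm//; ring.
have [e1|e1] := eqVneq `|1 + v| 1.
  have e2 : `|1 - v| != 1.
    apply: contra_neq v0 => e2; move: e1 e2.
    have [h|h] := leP 0 (1 + v); have [h'|h'] := leP 0 (1 - v);
      rewrite ?(ger0_norm h) ?(ltr0_norm h) ?(ger0_norm h') ?(ltr0_norm h') => ? ?; lra.
  have := bernoulli_lt p1 (normr_ge0 _) e2; have := bernoulli_le p1 (normr_ge0 (1 + v)).
  by nra.
have := bernoulli_lt p1 (normr_ge0 _) e1; have := bernoulli_le p1 (normr_ge0 (1 - v)).
by nra.
Qed.

Lemma paddr_midpoint_lt p s t : 1 < p -> t != 0 ->
  `|s| < 2^-1 * (`|paddr p s t| + `|paddr p s (- t)|).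
Proof.
move=> p1 t0; have p0 : 0 < p by lra.
have pn0 : p != 0 by rewrite gt_eqF.
rewrite /paddr spowN !norm_spow//.
have -> : `|s| = `|spow s p^-1| `^ p by rewrite norm_spow ?invr_eq0// powRVK.
apply: powR_midpoint_lt => //; apply: contra_neq t0 => h.
by rewrite -(spowVK t pn0) h /spow sgr0 mul0r.
Qed.

Lemma paddr0 p s : p != 0 -> paddr p s 0 = s.
Proof. by move=> p0; rewrite /paddr [spow 0 _]/spow sgr0 mul0r addr0 spowVK. Qed.

Lemma paddr_midpoint_le p s t : 1 < p ->
  `|s| <= 2^-1 * (`|paddr p s t| + `|paddr p s (- t)|).
Proof.
move=> p1; have [->|t0] := eqVneq t 0; last exact/ltW/paddr_midpoint_lt.
by rewrite oppr0 paddr0 ?gt_eqF//; lra.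
Qed.

(** The p-difference of |s| + |t| and |s|, that is, the v solving |s| (+) v = |s| + |t|. It is
    positive off t = 0, as [H2_gain] requires. *)
Definition psubr p s t := paddr p (`|s| + `|t|) (- `|s|).

Lemma psubrE p s t : 0 < p -> psubr p s t = ((`|s| + `|t|) `^ p^-1 - `|s| `^ p^-1) `^ p.
Proof.
move=> p0; have pn0 : p != 0 by rewrite gt_eqF.
rewrite /psubr /paddr spowN !(@spow_ge0E p^-1) ?invr_eq0 ?addr_ge0// spow_ge0E//.
have pV0 : 0 <= p^-1 by rewrite invr_ge0 ltW.
by rewrite subr_ge0; apply: ge0_ler_powR; rewrite // ?nnegrE ?addr_ge0// lerDl.
Qed.

Lemma psubr_ge0 p s t : 0 < p -> 0 <= psubr p s t.
Proof. by move=> p0; rewrite psubrE// powR_ge0. Qed.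

Lemma psubr_gt0 p s t : 0 < p -> t != 0 -> 0 < psubr p s t.
Proof.
move=> p0 t0; rewrite psubrE// powR_gt0// subr_gt0.
apply: gt0_ltr_powR; rewrite ?invr_gt0 ?nnegrE ?addr_ge0//.
by rewrite ltrDl normr_gt0.
Qed.

Lemma H2_psubr p : 0 < p -> H2 (psubr p).
Proof.
move=> p0; have Hs := H2norm (@H2_fst R); have Ht := H2norm (@H2_snd R).
have -> : psubr p = fun s t => paddr p (`|s| + `|t|) (-1 * `|s|).
  by apply/funext => s; apply/funext => t; rewrite mulN1r.
by apply: H2_comp; [exact: H2_paddr|exact: H2D|exact: H2Z].
Qed.

Lemma paddr_psubr p s t : 0 < p -> paddr p `|s| (psubr p s t) = `|s| + `|t|.
Proof.
move=> p0; have pn0 : p != 0 by rewrite gt_eqF.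
by rewrite {1}/paddr /psubr /paddr spowK// spowN addrC subrK spowVK.
Qed.

(** With A = |s|^(1/p) and B = (|s| + |t|)^(1/p) the left side is |2A - B|^p, and 0 <= A <= B gives
    |2A - B| <= B. *)
Lemma paddr_psubrN p s t : 0 < p -> `|paddr p `|s| (- psubr p s t)| <= `|s| + `|t|.
Proof.
move=> p0; have pn0 : p != 0 by rewrite gt_eqF.
have n0 : 0 <= `|s| + `|t| by rewrite addr_ge0.
rewrite {1}/paddr spowN /psubr /paddr spowK// spowN opprD opprK norm_spow//.
rewrite !(@spow_ge0E p^-1) ?invr_eq0// -[leRHS](powRVK n0 pn0).
set A := `|s| `^ p^-1; set B := (_ + _) `^ p^-1.
have pV0 : 0 <= p^-1 by rewrite invr_ge0 ltW.
have AB : A <= B by apply: ge0_ler_powR; rewrite // ?nnegrE ?addr_ge0// lerDl.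
have A0 : 0 <= A := powR_ge0 _ _.
apply: ge0_ler_powR; rewrite ?nnegrE ?powR_ge0 ?(ltW p0)//.
by rewrite ler_norml; apply/andP; split; lra.
Qed.

(** Where |t| exceeds e |s|, scaling brings t to 1 or -1 and s into [-1/e, 1/e]; k has a positive
    minimum m on these two segments, and C = 1/m works. Two segments are needed as homogeneity
    covers only nonnegative factors. *)
Lemma H2_gain k (e : R) : H2 k -> (forall s t, 0 <= k s t) ->
  (forall s t, t != 0 -> 0 < k s t) -> 0 < e ->
  exists2 C, 0 < C & forall s t, `|t| <= C * k s t + e * `|s|.
Proof.
move=> [kC kZ] k0 kpos e0; have Ne : - e^-1 <= e^-1.
  by have : 0 < e^-1 by [rewrite invr_gt0]; lra.
have kC1 c : {within `[- e^-1, e^-1], continuous (fun s => k s c)}.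
  apply: continuous_subspaceT => s.
  apply: (@cvg_comp2 _ _ _ _ (nbhs s) (nbhs s) (nbhs c) _ _ _ _ id (fun=> c) k).
  - exact: cvg_id.
  - exact: cvg_cst.
  - exact: (@kC (s, c)).
have [s1 _ h1] := EVT_min Ne (kC1 1); have [s2 _ h2] := EVT_min Ne (kC1 (-1)).
pose m := Num.min (k s1 1) (k s2 (-1)).
have m0 : 0 < m by rewrite lt_min !kpos ?oppr_eq0 ?oner_eq0.
exists m^-1 => [|s t]; first by rewrite invr_gt0.
have [->|t0] := eqVneq t 0.
  by rewrite normr0 addr_ge0// mulr_ge0 ?invr_ge0 ?k0 ?(ltW m0) ?(ltW e0).
have nt0 : 0 < `|t| by rewrite normr_gt0.
have [hs|hs] := leP `|t| (e * `|s|).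
  by apply: (le_trans hs); rewrite lerDr mulr_ge0// invr_ge0 ltW.
suff : m * `|t| <= k s t.
  move=> h; have : `|t| <= m^-1 * k s t by rewrite ler_pdivlMl.
  by have : 0 <= e * `|s| by [rewrite mulr_ge0// ltW]; lra.
pose s' := s / `|t|.
have s'in : s' \in `[- e^-1, e^-1].
  by rewrite in_itv /= -ler_norml normrM normfV normr_id ler_pdivrMr// ler_pdivlMl// ltW.
have kst c : t = `|t| * c -> k s t = `|t| * k s' c.
  move=> tE; rewrite {1}tE -(kZ `|t|)//; congr k.
  by rewrite /s' mulrCA divff ?gt_eqF// mulr1.
have [t1|t1] := leP 0 t.
  rewrite (kst 1); last by rewrite mulr1 ger0_norm.
  by rewrite mulrC ler_pM2l// ge_min h1.
rewrite (kst (-1)); last by rewrite mulrN1 ltr0_norm// opprK.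
by rewrite mulrC ler_pM2l// ge_min h2// orbT.
Qed.

(** * The complex modulus under quarter turns *)

Definition modC s t := Num.sqrt (s ^+ 2 + t ^+ 2).

Lemma H2_modC : H2 modC.
Proof.
split=> [v|a s t a0].
  apply: (continuous_compT (h := fun v : R * R => v.1 ^+ 2 + v.2 ^+ 2)
    _ (@sqrt_continuous R)) => w.
  by apply: cvgD; apply: cvgM; first [exact: fstC|exact: sndC].
by rewrite /modC !exprMn -mulrDr sqrtrM ?sqr_ge0// sqrtr_sqr ger0_norm.
Qed.

Lemma modC_ge0 s t : 0 <= modC s t. Proof. exact: sqrtr_ge0. Qed.

Lemma sqr_modC s t : modC s t ^+ 2 = s ^+ 2 + t ^+ 2.
Proof. by rewrite sqr_sqrtr// addr_ge0 ?sqr_ge0. Qed.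

Lemma modCs0 s : modC s 0 = `|s|.
Proof. by rewrite /modC expr0n addr0 sqrtr_sqr. Qed.

Lemma modC_le_l1 s t : modC s t <= `|s| + `|t|.
Proof.
rewrite -[leRHS]ger0_norm ?addr_ge0// -sqrtr_sqr; apply: ler_wsqrtr.
by rewrite sqrrD !real_normK ?num_real// addrAC lerDl mulrn_wge0.
Qed.

Lemma modCD s t s' t' : modC (s + s') (t + t') <= modC s t + modC s' t'.
Proof.
have m0 := modC_ge0 s t; have m'0 := modC_ge0 s' t'.
rewrite -[leRHS]ger0_norm ?addr_ge0// -sqrtr_sqr; apply: ler_wsqrtr.
have := sqr_modC s t; have := sqr_modC s' t'.
set m := modC s t; set m' := modC s' t' => e' e.
(* Cauchy-Schwarz, from (s t' - t s')^2 >= 0. *)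
have cs : s * s' + t * t' <= m * m'.
  apply: le_trans (ler_norm _) _; rewrite -[leRHS]ger0_norm ?mulr_ge0//.
  rewrite -ler_sqr ?nnegrE// !real_normK ?num_real// exprMn e e'.
  by have := sqr_ge0 (s * t' - t * s'); rewrite !expr2; lra.
by move: e e'; rewrite !expr2; lra.
Qed.

(** A quarter of 2 |s| + 2 sqrt(s^2 + t^2 / 2), the lower bound that [rotgain_le] proves for the sum
    of four moduli. *)
Definition rotgain s t := 2^-1 * (`|s| + modC s (t / Num.sqrt 2)).

Lemma H2_rotgain : H2 rotgain.
Proof.
apply: H2Z; apply: H2D; first exact/H2norm/H2_fst.
have -> : (fun s t => modC s (t / Num.sqrt 2)) =
    fun s t => modC s ((Num.sqrt 2)^-1 * t).
  by apply/funext => s; apply/funext => t; rewrite mulrC.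
by apply: H2_comp; [exact: H2_modC|exact: H2_fst|apply: H2Z; exact: H2_snd].
Qed.

Lemma rotgain_ge s t : `|s| <= rotgain s t.
Proof.
suff : `|s| <= modC s (t / Num.sqrt 2) by rewrite /rotgain; lra.
by rewrite -sqrtr_sqr; apply: ler_wsqrtr; rewrite lerDl sqr_ge0.
Qed.

Lemma rotgain_gt s t : t != 0 -> `|s| < rotgain s t.
Proof.
move=> t0; suff : `|s| < modC s (t / Num.sqrt 2) by rewrite /rotgain; lra.
have d0 : 0 < (t / Num.sqrt 2) ^+ 2.
  by rewrite exprn_even_gt0//= mulf_neq0// invr_eq0 gt_eqF// sqrtr_gt0.
by rewrite -sqrtr_sqr ltr_sqrt ?ltrDl// ltr_wpDl ?sqr_ge0.
Qed.

(** Here e is a lower bound for x y, given through squares because only (x y)^2 is a polynomial in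
    the coordinates. *)
Lemma antipodal_le x y d e : 0 <= x -> 0 <= y -> 0 <= d -> 0 <= e ->
  e ^+ 2 <= (x * y) ^+ 2 -> 4 * d ^+ 2 <= x ^+ 2 + y ^+ 2 + 2 * e -> 2 * d <= x + y.
Proof.
move=> x0 y0 d0 e0; rewrite ler_sqr ?nnegrE ?mulr_ge0// => exy h.
rewrite -ler_sqr ?nnegrE ?addr_ge0 ?mulr_ge0//.
by move: h; rewrite !expr2; lra.
Qed.

(* One antipodal pair contributes at least 2|a|; as Re(a b^* )^2 + Im(a b^* )^2
   is |a|^2 |b|^2, the better of the two pairs contributes at least
   2 sqrt(|a|^2 + |b|^2/2). *)
Lemma rotgain_le a1 a2 b1 b2 :
  4 * rotgain (modC a1 a2) (modC b1 b2) <=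
  modC (a1 + b1) (a2 + b2) + modC (a1 - b2) (a2 + b1) +
  modC (a1 - b1) (a2 - b2) + modC (a1 + b2) (a2 - b1).
Proof.
set x := modC (a1 + b1) _; set x' := modC (a1 - b1) _.
set y := modC (a1 - b2) _; set y' := modC (a1 + b2) _.
have x0 : 0 <= x := modC_ge0 _ _; have x'0 : 0 <= x' := modC_ge0 _ _.
have y0 : 0 <= y := modC_ge0 _ _; have y'0 : 0 <= y' := modC_ge0 _ _.
pose A := a1 ^+ 2 + a2 ^+ 2; pose B := b1 ^+ 2 + b2 ^+ 2.
have A0 : 0 <= A by rewrite addr_ge0 ?sqr_ge0.
have B0 : 0 <= B by rewrite addr_ge0 ?sqr_ge0.
pose r := a1 * b1 + a2 * b2; pose m := a2 * b1 - a1 * b2.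
have rm : r ^+ 2 + m ^+ 2 = A * B by rewrite /r /m /A /B; ring.
have xE : x ^+ 2 = A + B + 2 * r by rewrite sqr_modC /A /B /r; ring.
have x'E : x' ^+ 2 = A + B - 2 * r by rewrite sqr_modC /A /B /r; ring.
have yE : y ^+ 2 = A + B + 2 * m by rewrite sqr_modC /A /B /m; ring.
have y'E : y' ^+ 2 = A + B - 2 * m by rewrite sqr_modC /A /B /m; ring.
have xx' : (x * x') ^+ 2 = (A + B) ^+ 2 - 4 * r ^+ 2 by rewrite exprMn xE x'E; ring.
have yy' : (y * y') ^+ 2 = (A + B) ^+ 2 - 4 * m ^+ 2 by rewrite exprMn yE y'E; ring.
set a := modC a1 a2; have aE : a ^+ 2 = A := sqr_modC _ _.
have a0 : 0 <= a := modC_ge0 _ _.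
set d := modC a (modC b1 b2 / Num.sqrt 2); have d0 : 0 <= d := modC_ge0 _ _.
have dE : d ^+ 2 = A + B / 2.
  by rewrite /d sqr_modC aE expr_div_n sqr_modC sqr_sqrtr.
have -> : 4 * rotgain a (modC b1 b2) = 2 * a + 2 * d.
  by rewrite /rotgain (ger0_norm a0) -/d; lra.
have r2 := sqr_ge0 r; have m2 := sqr_ge0 m.
(* From w^2 <= A B one gets (u v)^2 >= (A - B)^2, so |A - B| bounds u v from below. *)
have small u v w : 0 <= u -> 0 <= v -> w ^+ 2 <= A * B ->
    u ^+ 2 + v ^+ 2 = 2 * (A + B) -> (u * v) ^+ 2 = (A + B) ^+ 2 - 4 * w ^+ 2 -> 2 * a <= u + v.
  move=> u0 v0 wAB uv uv2; apply: (@antipodal_le _ _ _ `|A - B|) => //.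
    by rewrite real_normK ?num_real// uv2; move: wAB; rewrite !expr2; lra.
  by rewrite aE uv; have := ler_norm (A - B); lra.
(* From 2 w^2 <= A B one gets (u v)^2 >= A^2 + B^2, so A bounds u v from below; this is what
   produces B / 2 in [d]. *)
have large u v w : 0 <= u -> 0 <= v -> 2 * w ^+ 2 <= A * B ->
    u ^+ 2 + v ^+ 2 = 2 * (A + B) -> (u * v) ^+ 2 = (A + B) ^+ 2 - 4 * w ^+ 2 -> 2 * d <= u + v.
  move=> u0 v0 wAB uv uv2; apply: (@antipodal_le _ _ _ A) => //.
    by rewrite uv2; move: wAB; have := sqr_ge0 B; rewrite !expr2; lra.
  by rewrite dE uv; lra.
have xs : x ^+ 2 + x' ^+ 2 = 2 * (A + B) by rewrite xE x'E; ring.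
have ys : y ^+ 2 + y' ^+ 2 = 2 * (A + B) by rewrite yE y'E; ring.
have [rm'|rm'] := leP (r ^+ 2) (m ^+ 2).
  have h1 := large _ _ r x0 x'0 ltac:(lra) xs xx'.
  by have h2 := small _ _ m y0 y'0 ltac:(lra) ys yy'; lra.
have h1 := large _ _ m y0 y'0 ltac:(lra) ys yy'.
by have h2 := small _ _ r x0 x'0 ltac:(lra) xs xx'; lra.
Qed.

End Powers.

(** * Monotonicity and convexity *)

Section Convexity.
Variables (R : realType) (E : completeNormedModType R) (le : E -> E -> Prop).
Hypothesis lattE : banach_lattice le.
Implicit Types (x y : E) (z w : E * E) (a b c e p q s t : R) (h k : R -> R -> R).

Lemma pideal4 x1 x2 x3 x4 : exists2 u, le 0 u &
  [/\ pideal le u x1, pideal le u x2, pideal le u x3 & pideal le u x4].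
Proof.
have h u v x : le 0 u -> le 0 v -> pideal le u x -> pideal le (u + v) x.
  move=> u0 v0 /(pideal_pos lattE u0)[a a0 [xa Nxa]].
  have auv : le (a *: u) (a *: (u + v)).
    apply: (bleZ lattE (ltW a0)); rewrite -[X in le X _]addr0.
    exact: (bleD lattE (ble_refl lattE u) v0).
  by exists a; split; exact: (ble_trans lattE _ auv).
have h' u v x : le 0 u -> le 0 v -> pideal le v x -> pideal le (u + v) x.
  by move=> u0 v0; rewrite addrC; exact: h.
have l0 := lmod_ge0 lattE; have ll0 := lmodD_ge0 lattE.
have Il x : pideal le (lmod le x) x by apply: pideal_ble => //; exact: ble_refl.
exists (lmod le x1 + lmod le x2 + (lmod le x3 + lmod le x4)).
  by rewrite -(addr0 0); exact: bleD.
have hx x y : pideal le (lmod le x + lmod le y) x by exact: (h _ _ _ (l0 x) (l0 y)).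
have hy x y : pideal le (lmod le x + lmod le y) y by exact: (h' _ _ _ (l0 x) (l0 y)).
by split; [apply: h|apply: h|apply: h'|apply: h']; first [exact: hx|exact: hy|exact: ll0].
Qed.

Lemma pideal2 x1 x2 : exists u, [/\ le 0 u, pideal le u x1 & pideal le u x2].
Proof. by have [u u0 [h1 h2 _ _]] := pideal4 x1 x2 x1 x2; exists u. Qed.

(** By [H2_gain] with e / 2, |y| <= C k(x, y) + (e / 2) |x|; as x has norm 1, the last term costs at
    most half of the norm of y. *)
Lemma gain_norm k e : H2 k -> (forall s t, 0 <= k s t) ->
  (forall s t, t != 0 -> 0 < k s t) -> 0 < e ->
  exists2 e', 0 < e' & forall x y, `|x| = 1 -> e <= `|y| ->
    e' <= `|krivine2 le k x y|.
Proof.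
move=> Hk k0 kpos e0; have e20 : 0 < e / 2 by rewrite divr_gt0.
have [C C0 hC] := H2_gain Hk k0 kpos e20.
exists (e / 2 / C) => [|x y x1 ey]; first by rewrite divr_gt0.
have [u [u0 Ix Iy]] := pideal2 x y.
have IK := pideal_krivine2 lattE u0 Hk Ix Iy.
have Il := pideal_lmod lattE u0 Ix.
have : `|y| <= `|C *: krivine2 le k x y + (e / 2) *: lmod le x|.
  apply: (norm_le_char lattE u0) => //.
    by apply: pidealD => //; exact: pidealZ.
  move=> phi chphi; rewrite (lcharD chphi); try exact: pidealZ.
  rewrite !(lcharZ chphi)// (lchar_lmod chphi)// (lchar_krivine2 lattE u0)//.
  by apply: le_trans (hC _ _) _; exact: ler_norm.
move=> h; rewrite ler_pdivrMr// mulrC.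
have := le_trans h (ler_normD _ _).
by rewrite !normrZ norm_lmod// x1 !gtr0_norm//; lra.
Qed.

(** Upper monotonicity is used at k(x, y) with k = h - |s|, which [gain_norm] keeps away from 0.
    Since [qsum] is at most the l^1 sum, the resulting element is dominated by |x| + k(x, y) = h(x,
    y). *)
Lemma ULUM_gain h : ULUM le -> H2 h -> (forall s t, `|s| <= h s t) ->
  (forall s t, t != 0 -> `|s| < h s t) ->
  forall x, `|x| = 1 -> forall e, 0 < e -> exists2 d, 0 < d &
    forall y, e <= `|y| -> 1 + d <= `|krivine2 le h x y|.
Proof.
move=> [q [q1 ulum]] Hh hge hgt x x1 e e0.
have Hq : H2 (@qsum R q) by apply: H2_qsum; lra.
pose k s t := h s t + -1 * `|s|.
have Hk : H2 k by apply: H2D => //; apply: H2Z; apply: H2norm; exact: H2_fst.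
have k0 s t : 0 <= k s t by have := hge s t; rewrite /k; lra.
have kpos s t : t != 0 -> 0 < k s t.
  by move=> t0; have := @hgt s t t0; rewrite /k; lra.
have [e' e'0 he'] := gain_norm Hk k0 kpos e0.
have [d d0 hd] := ulum x x1 e' e'0; exists d => // y ey.
apply: le_trans (hd _ (he' _ _ x1 ey)) _.
have [u [u0 Ix Iy]] := pideal2 x y.
have IK := pideal_krivine2 lattE u0 Hk Ix Iy.
apply: (norm_le_char lattE u0); try exact: pideal_krivine2.
move=> phi chphi; rewrite !(lchar_krivine2 lattE u0)//.
rewrite ger0_norm ?qsum_ge0// (le_trans (qsum_le _ _ q1))//.
by apply: le_trans (ler_norm _); rewrite (ger0_norm (k0 _ _)) /k; lra.
Qed.

Lemma ULUM_of_sum : (forall x, `|x| = 1 -> forall e, 0 < e ->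
    exists2 d, 0 < d & forall y, e <= `|y| -> 1 + d <= `|lmod le x + lmod le y|) ->
  ULUM le.
Proof.
move=> hsum; exists 1; split=> // x x1 e e0.
have [d d0 hd] := hsum x x1 e e0; exists d => // y ey.
suff -> : `|krivine2 le (qsum 1) x y| = `|lmod le x + lmod le y| by exact: hd.
have Hq : H2 (@qsum R 1) by exact: H2_qsum.
have [u [u0 Ix Iy]] := pideal2 x y.
have Ilx := pideal_lmod lattE u0 Ix; have Ily := pideal_lmod lattE u0 Iy.
apply: (norm_eq_char lattE u0); first exact: pideal_krivine2.
  exact: pidealD.
move=> phi chphi; rewrite (lchar_krivine2 lattE u0)// qsum1.
by rewrite (lcharD chphi)// !(lchar_lmod chphi).
Qed.

(** * Complex convexity of the complexification *)

Lemma cnormE z : cnorm le z = `|krivine2 le (@modC R) z.1 z.2|.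
Proof. by []. Qed.

Lemma cnorm_ge0 z : 0 <= cnorm le z. Proof. exact: normr_ge0. Qed.

(** This Lipschitz bound serves to make the integrand continuous in the angle. *)
Lemma cnorm_le_dist z w : cnorm le z <= cnorm le w + (`|z.1 - w.1| + `|z.2 - w.2|).
Proof.
have [u u0 [I1 I2 J1 J2]] := pideal4 z.1 z.2 w.1 w.2.
have Hm := @H2_modC R.
rewrite -(norm_lmod lattE (z.1 - _)) -(norm_lmod lattE (z.2 - _)) !cnormE.
have D1 := pidealB lattE I1 J1; have D2 := pidealB lattE I2 J2.
have L1 := pideal_lmod lattE u0 D1; have L2 := pideal_lmod lattE u0 D2.
have IK := pideal_krivine2 lattE u0 Hm J1 J2.
apply: le_trans (le_trans (ler_normD _ _) (lerD (lexx _) (ler_normD _ _))).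
have LL := pidealD lattE L1 L2.
apply: (norm_le_char lattE u0); [exact: pideal_krivine2|exact: pidealD|].
move=> phi chphi; rewrite !(lcharD chphi)// !(lchar_lmod chphi)//.
rewrite !(lcharB chphi)// !(lchar_krivine2 lattE u0)// ger0_norm ?modC_ge0//.
apply: le_trans (ler_norm _).
have := modCD (phi z.1 - phi w.1) (phi z.2 - phi w.2) (phi w.1) (phi w.2).
rewrite !subrK => /le_trans; apply.
by rewrite addrC lerD2l modC_le_l1.
Qed.

Lemma cnorm_crot_continuous z w : continuous (fun th => cnorm le (crot z w th)).
Proof.
move=> th; have cC := @continuous_cos R; have sC := @continuous_sin R.
have C1 : continuous (fun th => (crot z w th).1).
  move=> v; apply: cvgD; first exact: cvg_cst.
  by apply: cvgB; apply: cvgZr_tmp; first [exact: cC|exact: sC].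
have C2 : continuous (fun th => (crot z w th).2).
  move=> v; apply: cvgD; first exact: cvg_cst.
  by apply: cvgD; apply: cvgZr_tmp; first [exact: cC|exact: sC].
apply/cvgrPdist_lt => e e0; have e20 : 0 < e / 2 by rewrite divr_gt0.
have /cvgrPdist_lt/(_ _ e20) h1 := C1 th.
have /cvgrPdist_lt/(_ _ e20) := C2 th.
apply: filterS2 h1 => v h1 h2.
have := cnorm_le_dist (crot z w th) (crot z w v).
have := cnorm_le_dist (crot z w v) (crot z w th).
rewrite distrC [X in _ + (_ + X)]distrC => h3 h4.
by rewrite ltr_norml; apply/andP; split; lra.
Qed.

Lemma crot_pihalf z w th : crot z w (th + pi / 2) =
  (z.1 - (sin th *: w.1 + cos th *: w.2), z.2 + (cos th *: w.1 - sin th *: w.2)).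
Proof. by rewrite /crot sinDpihalf cosDpihalf !scaleNr opprD. Qed.

Lemma crot_pi z w th : crot z w (th + pi) =
  (z.1 - (cos th *: w.1 - sin th *: w.2), z.2 - (sin th *: w.1 + cos th *: w.2)).
Proof. by rewrite /crot sinDpi cosDpi !scaleNr !opprD opprK. Qed.

Lemma crot_3pihalf z w th : crot z w (th + 3 * pi / 2) =
  (z.1 + (sin th *: w.1 + cos th *: w.2), z.2 - (cos th *: w.1 - sin th *: w.2)).
Proof.
have -> : th + 3 * pi / 2 = th + pi + pi / 2 by lra.
by rewrite crot_pihalf sinDpi cosDpi !scaleNr -!opprD opprK.
Qed.

Lemma modC_rot th s t :
  modC (cos th * s - sin th * t) (sin th * s + cos th * t) = modC s t.
Proof.
congr Num.sqrt; transitivity ((cos th ^+ 2 + sin th ^+ 2) * (s ^+ 2 + t ^+ 2)).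
  by ring.
by rewrite cos2Dsin2 mul1r.
Qed.

(** The scalar bound [rotgain_le] involves w only through its modulus, which the rotation by [th]
    preserves; the left side is therefore free of the angle. *)
Lemma cnorm_rotations_ge z w th :
  4 * `|krivine2 le (@rotgain R) (krivine2 le (@modC R) z.1 z.2)
                                 (krivine2 le (@modC R) w.1 w.2)| <=
  cnorm le (crot z w th) + cnorm le (crot z w (th + pi / 2)) +
  cnorm le (crot z w (th + pi)) + cnorm le (crot z w (th + 3 * pi / 2)).
Proof.
have [u u0 [I1 I2 J1 J2]] := pideal4 z.1 z.2 w.1 w.2.
have Hm := @H2_modC R; have Hg := @H2_rotgain R.
rewrite crot_pihalf crot_pi crot_3pihalf /crot.
set b1 := cos th *: w.1 - _; set b2 := sin th *: w.1 + _.
have Jz a x : pideal le u x -> pideal le u (a *: x) by exact: pidealZ.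
have B1 : pideal le u b1 by apply: pidealB => //; exact: Jz.
have B2 : pideal le u b2 by apply: pidealD => //; exact: Jz.
have modE phi : lattice_char le u phi ->
    modC (phi w.1) (phi w.2) = modC (phi b1) (phi b2).
  move=> chphi; rewrite /b1 /b2 (lcharB chphi); try exact: Jz.
  rewrite (lcharD chphi); try exact: Jz.
  by rewrite !(lcharZ chphi)// modC_rot.
clearbody b1 b2.
have [X1 Y1] := (pidealD lattE I1 B1, pidealD lattE I2 B2).
have [X2 Y2] := (pidealB lattE I1 B2, pidealD lattE I2 B1).
have [X3 Y3] := (pidealB lattE I1 B1, pidealB lattE I2 B2).
have [X4 Y4] := (pidealD lattE I1 B2, pidealB lattE I2 B1).
have IK x y : pideal le u x -> pideal le u y ->
  pideal le u (krivine2 le (@modC R) x y) by exact: pideal_krivine2.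
rewrite !cnormE /=; set K1 := krivine2 le _ (z.1 + b1) _.
set K2 := krivine2 le _ (z.1 - b2) _; set K3 := krivine2 le _ (z.1 - b1) _.
set K4 := krivine2 le _ (z.1 + b2) _.
have IK1 : pideal le u K1 := IK _ _ X1 Y1.
have IK2 : pideal le u K2 := IK _ _ X2 Y2.
have IK3 : pideal le u K3 := IK _ _ X3 Y3.
have IK4 : pideal le u K4 := IK _ _ X4 Y4.
have I12 := pidealD lattE IK1 IK2; have I123 := pidealD lattE I12 IK3.
have IG : pideal le u (krivine2 le (@rotgain R) (krivine2 le (@modC R) z.1 z.2)
                                 (krivine2 le (@modC R) w.1 w.2)).
  by apply: pideal_krivine2 => //; exact: IK.
apply: (@le_trans _ _ `|K1 + K2 + K3 + K4|); last first.
  by do 3 (apply: (le_trans (ler_normD _ _)); rewrite lerD2r).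
rewrite -[4 in leLHS]ger0_norm// -normrZ.
apply: (norm_le_char lattE u0); [exact: Jz|exact: pidealD|].
move=> phi chphi; rewrite (lcharZ chphi)// !(lcharD chphi)// /K1 /K2 /K3 /K4.
rewrite !(lchar_krivine2 lattE u0)//; try exact: IK.
rewrite modE// !(lcharB chphi)// !(lcharD chphi)//.
rewrite ger0_norm; first by apply: le_trans (rotgain_le _ _ _ _) (ler_norm _).
by rewrite mulr_ge0// (le_trans _ (rotgain_ge _ _)).
Qed.

(** Complex strong extremality is shown with exponent 1. [ULUM_gain] is applied in [E] to the moduli
    of z and w, whose norms are [cnorm z] and [cnorm w]. *)
Lemma ULUM_LUCC : ULUM le -> LUCC le.
Proof.
move=> ulum z z1; exists 1; split=> // e e0.
have [d d0 hd] := ULUM_gain ulum (@H2_rotgain R) (@rotgain_ge R) (@rotgain_gt R) z1 e0.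
exists d => // w ew; apply: le_trans (hd _ ew) _.
set c := `|krivine2 le _ _ _|.
have -> : (fun th => cnorm le (crot z w th) `^ 1) = (fun th => cnorm le (crot z w th)).
  by apply/funext => th; rewrite powRr1 ?cnorm_ge0.
have pi0 : 0 < pi :> R := pi_gt0 R.
have h : c * (2 * pi) <= Rintegral lebesgue_measure `[0, 2 * pi]
    (fun th => cnorm le (crot z w th)).
  apply: Rintegral_quarters_ge; first exact: cnorm_crot_continuous.
  by move=> th; exact: cnorm_rotations_ge.
have h' : c <= (2 * pi)^-1 * Rintegral lebesgue_measure `[0, 2 * pi]
    (fun th => cnorm le (crot z w th)).
  by rewrite mulrC ler_pdivlMr// mulr_gt0.
by rewrite invr1 powRr1 ?h'//; exact: le_trans (normr_ge0 _) h'.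
Qed.

Lemma lchar0 u phi : le 0 u -> lattice_char le u phi -> phi 0 = 0.
Proof.
move=> u0 chphi; rewrite -[0 in LHS](scale0r (0 : E)) (lcharZ chphi) ?mul0r//.
exact: pideal0.
Qed.

Lemma cnorm_real x : cnorm le (x, 0) = `|x|.
Proof.
have [u [u0 Ix I0]] := pideal2 x 0; rewrite cnormE.
apply: (norm_eq_char lattE u0) => //.
  by apply: pideal_krivine2 => //; exact: H2_modC.
move=> phi chphi; rewrite (lchar_krivine2 lattE u0)//; last exact: H2_modC.
by rewrite (lchar0 u0)//= modCs0 normr_id.
Qed.

Lemma cnorm_crot_real_le x y th :
  cnorm le (crot (x, 0) (y, 0) th) <= `|lmod le x + lmod le y|.
Proof.
have [u u0 [Ix Iy I0 _]] := pideal4 x y 0 0; rewrite cnormE /=.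
rewrite !scaler0 subr0 addr0 add0r.
have Jz a : pideal le u (a *: y) by exact: pidealZ.
have IX := pidealD lattE Ix (Jz (cos th)).
have Lx := pideal_lmod lattE u0 Ix; have Ly := pideal_lmod lattE u0 Iy.
have Hm := @H2_modC R.
apply: (norm_le_char lattE u0); [exact: pideal_krivine2|exact: pidealD|].
move=> phi chphi; rewrite (lchar_krivine2 lattE u0)// !(lcharD chphi)//.
rewrite !(lcharZ chphi)// !(lchar_lmod chphi)// ger0_norm ?modC_ge0//.
apply: le_trans (ler_norm _).
have := modCD (phi x) 0 (cos th * phi y) (sin th * phi y); rewrite add0r modCs0.
by have := modC_rot th (phi y) 0; rewrite !mulr0 subr0 addr0 modCs0 => ->.
Qed.

(** At the real points (x, 0) and (y, 0) the integrand is at most M^q for every angle, M being the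
    norm of |x| + |y|, so the q-mean is at most M whatever q is. *)
Lemma LUCC_ULUM : LUCC le -> ULUM le.
Proof.
move=> lucc; apply: ULUM_of_sum => x x1 e e0.
have [|q [q0 hq]] := lucc (x, 0); first by rewrite cnorm_real.
have [d d0 hd] := hq e e0; exists d => // y ey.
apply: le_trans (hd (y, 0) _) _; first by rewrite cnorm_real.
set M := `|_ + _|; have M0 : 0 <= M := normr_ge0 _.
have pi0 : 0 < pi :> R := pi_gt0 R; have qn0 : q != 0 by rewrite gt_eqF.
have cC : continuous (fun th => cnorm le (crot (x, 0) (y, 0) th) `^ q).
  have -> : (fun th => cnorm le (crot (x, 0) (y, 0) th) `^ q) =
      (fun th => `|cnorm le (crot (x, 0) (y, 0) th)| `^ q).
    by apply/funext => th; rewrite ger0_norm ?cnorm_ge0.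
  exact: (continuous_compT (@cnorm_crot_continuous (x, 0) (y, 0)) (powR_norm_continuous q0)).
rewrite -[leRHS](powRK M0 qn0); apply: ge0_ler_powR.
- by rewrite invr_ge0 ltW.
- rewrite nnegrE mulr_ge0 ?invr_ge0 ?mulr_ge0 ?(ltW pi0)//.
  by apply: Rintegral_ge0 => th _; exact: powR_ge0.
- by rewrite nnegrE powR_ge0.
rewrite mulrC ler_pdivrMr ?mulr_gt0//.
have -> : M `^ q * (2 * pi) = \int[lebesgue_measure]_(x in `[0, 2 * pi]) (M `^ q).
  by rewrite Rintegral_itv_cst ?subr0// mulr_ge0// ltW.
apply: le_Rintegral => //; first exact: integrable_continuous_itv.
  by apply: integrable_continuous_itv => th; exact: cst_continuous.
move=> th _; apply: ge0_ler_powR; rewrite ?nnegrE ?cnorm_ge0 ?(ltW q0)//.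
exact: cnorm_crot_real_le.
Qed.

(** * Midpoint convexity of the convexification *)

Lemma pnormE p x : p != 0 -> (pnorm p x = 1) <-> (`|x| = 1).
Proof.
move=> p0; rewrite /pnorm; split=> [h|->]; last by rewrite powR1.
by rewrite -(@powRVK _ p `|x|)// h powR1.
Qed.

Lemma pscN1 p x : psc p (-1) x = - x.
Proof. by rewrite /psc /spow sgrN1 normrN normr1 powR1 mulr1 scaleN1r. Qed.

Lemma ULUM_midpoint p : ULUM le -> 1 < p -> midpoint_LUC_conv le p.
Proof.
move=> ulum p1 x px e e0; have p0 : 0 < p by lra.
have pn0 : p != 0 by rewrite gt_eqF.
have pV0 : 0 < p^-1 by rewrite invr_gt0.
have x1 : `|x| = 1 by apply/(pnormE _ pn0).
pose h s t := 2^-1 * (`|paddr p s t| + `|paddr p s (- 1 * t)|).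
have HN : H2 (fun s t : R => -1 * t) := H2Z (-1) (@H2_snd R).
have Hp := @H2_paddr R p p0.
have Hh : H2 h.
  exact: (H2Z 2^-1 (H2D (H2norm Hp) (H2norm (H2_comp Hp (@H2_fst R) HN)))).
have hge s t : `|s| <= h s t by rewrite /h mulN1r paddr_midpoint_le.
have hgt s t : t != 0 -> `|s| < h s t.
  by rewrite /h mulN1r; exact: paddr_midpoint_lt.
(* The threshold e for [pnorm] is the threshold e^p for the norm of [E]; likewise the gain 1 + d
   turns into (1 + d)^(1/p). *)
have [d d0 hd] := ULUM_gain ulum Hh hge hgt x1 (powR_gt0 p e0).
exists ((1 + d) `^ p^-1 - 1).
  have one : 1 `^ p^-1 = 1 :> R by rewrite powR1.
  by rewrite subr_gt0 -[ltLHS]one gt0_ltr_powR ?nnegrE//; lra.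
move=> y ey; rewrite addrC subrK.
have ey' : e `^ p <= `|y|.
  rewrite -(@powRVK _ p `|y|)//.
  by apply: ge0_ler_powR; rewrite ?nnegrE ?powR_ge0 ?(ltW e0) ?(ltW p0).
rewrite pscN1.
set f := padd le p x y; set g := padd le p x (- y).
have [u [u0 Ix Iy]] := pideal2 x y; have INy := pidealN Iy.
have IKf : pideal le u f := pideal_krivine2 lattE u0 Hp Ix Iy.
have IKg : pideal le u g := pideal_krivine2 lattE u0 Hp Ix INy.
have Lf := pideal_lmod lattE u0 IKf; have Lg := pideal_lmod lattE u0 IKg.
have LL := pidealD lattE Lf Lg.
have hfg : `|krivine2 le h x y| <= 2^-1 * (`|f| + `|g|).
  rewrite -(norm_lmod lattE f) -(norm_lmod lattE g).
  apply: (@le_trans _ _ `|2^-1 *: (lmod le f + lmod le g)|); last first.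
    by rewrite normrZ ger0_norm// ler_pM2l// ler_normD.
  apply: (norm_le_char lattE u0); [exact: pideal_krivine2|exact: pidealZ|].
  move=> phi chphi; rewrite (lcharZ chphi)// (lcharD chphi)// !(lchar_lmod chphi)//.
  have -> : phi f = paddr p (phi x) (phi y) by exact: (lchar_krivine2 lattE u0 Hp Ix Iy chphi).
  have -> : phi g = paddr p (phi x) (- phi y).
    by rewrite -(lcharN chphi Iy); exact: (lchar_krivine2 lattE u0 Hp Ix INy chphi).
  by rewrite (lchar_krivine2 lattE u0 Hh Ix Iy chphi) /h mulN1r.
have := le_trans (hd _ ey') hfg.
have mono a b : 0 <= a -> a <= b -> a `^ p^-1 <= b `^ p^-1 by exact: (powR_le (ltW pV0)).
have d1 : 0 <= 1 + d by lra.
(* The larger of the two norms is at least their mean. *)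
move=> hd'; have [fg|fg] := leP `|f| `|g|.
  by rewrite le_max /pnorm (mono _ `|g|)// ?orbT//; lra.
by rewrite le_max /pnorm (mono _ `|f|)//; lra.
Qed.

(** Midpoint convexity is used at |x| in the direction v = psubr(x, y). Both |x| (+) v and |x| (-) v
    have norm at most that of |x| + |y|, so the maximum in the definition gives no escape. *)
Lemma midpoint_ULUM p : 1 < p -> midpoint_LUC_conv le p -> ULUM le.
Proof.
move=> p1 mluc; have p0 : 0 < p by lra.
have pn0 : p != 0 by rewrite gt_eqF.
have pV0 : 0 < p^-1 by rewrite invr_gt0.
have Hp := @H2_paddr R p p0; have Hs := @H2_psubr R p p0.
apply: ULUM_of_sum => x x1 e e0.
have [e' e'0 he'] := gain_norm Hs (fun s t => psubr_ge0 s t p0)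
  (fun s t => psubr_gt0 s p0) e0.
have [|d d0 hd] := mluc (lmod le x) _ (e' `^ p^-1) (powR_gt0 _ e'0).
  by apply/(pnormE _ pn0); rewrite norm_lmod.
exists d => // y ey.
have mono a b : 0 <= a -> a <= b -> a `^ p^-1 <= b `^ p^-1 by exact: (powR_le (ltW pV0)).
set v := krivine2 le (psubr p) x y.
have /hd : e' `^ p^-1 <= pnorm p v by apply: mono; [exact: ltW|exact: he'].
rewrite pscN1.
set M := `|_ + _|; have M0 : 0 <= M := normr_ge0 _.
have [u [u0 Ix Iy]] := pideal2 x y.
have Iv : pideal le u v := pideal_krivine2 lattE u0 Hs Ix Iy.
have INv := pidealN Iv.
have Lx := pideal_lmod lattE u0 Ix; have Ly := pideal_lmod lattE u0 Iy.
have fM : `|padd le p (lmod le x) v| <= M.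
  apply: (norm_le_char lattE u0 (pideal_krivine2 lattE u0 Hp Lx Iv) (pidealD lattE Lx Ly)).
  move=> phi chphi; rewrite (lcharD chphi Lx Ly) /padd.
  have -> : phi (krivine2 le (paddr p) (lmod le x) v) = paddr p (phi (lmod le x)) (phi v).
    exact: (lchar_krivine2 lattE u0 Hp Lx Iv chphi).
  rewrite /v (lchar_krivine2 lattE u0 Hs Ix Iy chphi).
  by rewrite (lchar_lmod chphi Ix) (lchar_lmod chphi Iy) paddr_psubr.
have gM : `|padd le p (lmod le x) (- v)| <= M.
  apply: (norm_le_char lattE u0 (pideal_krivine2 lattE u0 Hp Lx INv) (pidealD lattE Lx Ly)).
  move=> phi chphi; rewrite (lcharD chphi Lx Ly) /padd.
  have -> : phi (krivine2 le (paddr p) (lmod le x) (- v)) = paddr p (phi (lmod le x)) (phi (- v)).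
    exact: (lchar_krivine2 lattE u0 Hp Lx INv chphi).
  rewrite (lcharN chphi Iv) /v (lchar_krivine2 lattE u0 Hs Ix Iy chphi).
  rewrite (lchar_lmod chphi Ix) (lchar_lmod chphi Iy).
  exact: (le_trans (paddr_psubrN _ _ p0) (ler_norm _)).
move=> h; have {}h : 1 + d <= M `^ p^-1.
  by apply: (le_trans h); rewrite ge_max /pnorm !mono.
have d1 : 1 <= 1 + d by lra.
(* The p-th root is removed by 1 + d <= (1 + d)^p <= M. *)
apply: (le_trans (le1r_powR d1 (ltW p1))).
by rewrite -[leRHS](powRVK M0 pn0); apply: ge0_ler_powR; rewrite ?nnegrE ?powR_ge0 ?(ltW p0)//; lra.
Qed.

End Convexity.

Theorem theorem3p3 (R : realType) (E : completeNormedModType R)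
    (le : E -> E -> Prop) :
  banach_lattice le ->
  order_continuous le \/ kothe_function_space le ->
  [/\ (ULUM le <-> LUCC le),
      (LUCC le <-> (forall p : R, 1 < p -> midpoint_LUC_conv le p)) &
      ((forall p : R, 1 < p -> midpoint_LUC_conv le p) <->
       (exists2 p : R, 1 < p & midpoint_LUC_conv le p))].
Proof.
move=> lattE _.
have h12 := ULUM_LUCC lattE; have h21 := LUCC_ULUM lattE.
have h13 p : ULUM le -> 1 < p -> midpoint_LUC_conv le p := @ULUM_midpoint _ _ _ lattE p.
have h41 p : 1 < p -> midpoint_LUC_conv le p -> ULUM le := @midpoint_ULUM _ _ _ lattE p.
have p2 : 1 < 2 :> R by rewrite ltr1n.
split; split=> //.
- by move=> /h21 + p; exact: h13.
- by move=> /(_ 2 p2)/(h41 _ p2)/h12.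
- by move=> h; exists 2 => //; exact: h.
- by move=> [p p1 /(h41 _ p1) ulum] r; exact: h13.
Qed.
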